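(* Let $X$ be a non-separable (real) Banach space. Then: (i) if $X$ is quasi-reflexive, the unit sphere of $X$ contains an uncountable $(1+)$-separated subset; (ii) if $X$ is super-reflexive, then for each regular cardinal number $\kappa$ that does not exceed the density of $X$ there exist $\varepsilon>0$ and a $(1+\varepsilon)$-separated subset of the unit sphere of $X$ that has cardinality $\kappa$. In particular, the unit sphere of a non-separable super-reflexive space contains an uncountable $(1+\varepsilon)$-separated subset for some $\varepsilon>0$; (iii) if $X$ is a weakly Lindelöf determined (WLD) Banach space of density bigger than the continuum $\mathfrak{c}$, the unit sphere of $X^*$ contains an uncountable $(1+)$-separated subset.
   Context: Banach spaces are real. A subset $A$ of a Banach space is $(1+)$-separated if $\|x-y\|>1$ for all distinct $x,y\in A$; for $\delta>0$ it is $\delta$-separated if $\|x-y\|\geq\delta$ for all distinct $x,y\in A$ (so $(1+\varepsilon)$-separated means $\|x-y\|\geq 1+\varepsilon$ for all distinct $x,y\in A$). The density of $X$ is the minimal cardinality of a dense subset of $X$. A cardinal $\kappa$ is regular if it equals its cofinality. $X$ is quasi-reflexive if $X^{**}/X$ is finite-dimensional. $X$ is super-reflexive if each ultrapower of $X$ is reflexive. $X$ is weakly Lindelöf determined (WLD) if for some set $\Gamma$ the dual unit ball $B_{X^*}$ with the weak$^*$ topology is homeomorphic to a subset of $\{x\in\mathbb{R}^\Gamma : \{\gamma\in\Gamma : x(\gamma)\neq 0\}\text{ is countable}\}$ that is compact in the topology of pointwise convergence. *)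

(* Defs.v *)
From HB Require Import structures.
From mathcomp Require Import all_boot all_order all_algebra.
From mathcomp Require Import generic_quotient wochoice.
From mathcomp Require Import all_classical all_reals all_analysis.

Set Implicit Arguments.
Unset Strict Implicit.
Unset Printing Implicit Defensive.

Import Order.TTheory GRing.Theory Num.Theory.
Import numFieldNormedType.Exports.

Local Open Scope classical_set_scope.
Local Open Scope ring_scope.
Local Open Scope card_scope.

Section Cardinals.

Definition card_lt {T U : Type} (A : set T) (B : set U) : Prop :=
  A #<= B /\ ~ (B #<= A).

(* A member of least cardinality of the family [P]; such a member exists as
   soon as [P] is nonempty, see [min_cardP]. *)
Definition min_card {T : Type} (P : set (set T)) : set T :=
  xget set0 [set A | P A /\ forall B, P B -> A #<= B].

Lemma min_cardP {T : Type} (P : set (set T)) : P !=set0 ->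
  P (min_card P) /\ forall B, P B -> min_card P #<= B.
Proof.
move=> [A0 PA0]; suff : exists A, P A /\ forall B, P B -> A #<= B.
  exact: (@xgetPex _ set0 [set A | P A /\ forall B, P B -> A #<= B]).
have [P0|nP0] := pselect (P set0).
  by exists set0; split=> // B _; exact: card_le0x.
pose Q (S : set (set T -> T)) :=
  (forall s, S s -> forall A, P A -> A (s A)) /\
  (forall s s', S s -> S s' -> forall A, P A -> s A = s' A -> s = s').
have [F FQ Ftot|S [[Sin Sinj] Smax]] := @Zorn_bigcup _ Q.
  split=> [s [S FS Ss] A PA|s s' [S FS Ss] [S' FS' Ss'] A PA].
    exact: (FQ _ FS).1 Ss _ PA.
  by have [SS'|S'S] := Ftot _ _ FS FS';
    [apply: (FQ _ FS').2 => //; exact: SS'|apply: (FQ _ FS).2 => //; exact: S'S].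
have [A PA Asurj] : exists2 A, P A & forall a, A a -> exists2 s, S s & s A = a.
  apply: contrapT => noA.
  have /choice[t tP] : forall A, exists a,
      P A -> A a /\ forall s, S s -> s A <> a.
    move=> A; have [PA|nPA] := pselect (P A); last first.
      have /set0P[a _] : A0 != set0 by apply/eqP => A00; apply: nP0; rewrite -A00.
      by exists a.
    apply: contrapT => noa; apply: noA; exists A => // a Aa.
    apply: contrapT => nos; apply: noa; exists a => _; split=> // s Ss sAa.
    by apply: nos; exists s.
  apply: (Smax (t |` S)).
    split; first by move=> s; right.
    by move=> /(_ t (or_introl erefl)) St; exact: (tP _ PA0).2 St erefl.
  split=> [s [->|Ss] A PA|s s2 [->|Ss] [->|Ss2] A PA //].
  - exact: (tP A PA).1.
  - exact: (Sin s Ss A PA).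
  - by move=> /esym/((tP A PA).2 _ Ss2).
  - by move=> /((tP A PA).2 _ Ss).
  - exact: (Sinj s s2 Ss Ss2 A PA).
exists A; split=> // B PB.
apply: (@card_le_trans _ _ _ S).
  apply: (@card_le_trans _ _ _ ((fun s => s A) @` S)).
    by apply: subset_card_le => a /Asurj[s Ss <-]; exists s.
  exact: card_image_le.
have evB : (fun s => s B) @` S #= S.
  apply: inj_card_eq => s s' /set_mem Ss /set_mem Ss' /=; exact: Sinj PB.
rewrite -(card_le_eql evB); apply: subset_card_le => _ [s Ss <-].
exact: (Sin s Ss B PB).
Qed.

Definition cofinal {K : Type} (r : rel K) (A : set K) : Prop :=
  forall x, exists2 y, A y & r x y.

(* [r] has the order type of an initial ordinal: it is a well-order all of
   whose proper initial segments are smaller than the whole. *)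
Definition initial_well_order {K : Type} (r : rel K) : Prop :=
  well_order r /\ forall x, card_lt [set y | ~~ r x y] [set: K].

Definition cofinality {K : Type} (r : rel K) : set K := min_card (cofinal r).

(* Cardinals are represented by types.  Initial well-orders of [K] are
   isomorphic, so the choice of [r] is irrelevant.  Infiniteness is not
   required; the only finite [K] satisfying this are those with at most one
   element. *)
Definition regular_cardinal (K : Type) : Prop :=
  exists2 r : rel K, initial_well_order r & [set: K] #= cofinality r.

End Cardinals.

Section QuotientModule.
Variables (R : pzRingType) (V : lmodType R).

(* [S] tagged with the proof that it is a submodule, so that structure
   inference can recover it. *)
Definition quot_pred (S : {pred V}) (subS : submod_closed S) : {pred V} := S.

Section Instances.
Variables (S : {pred V}) (subS : submod_closed S).

HB.instance Definition _ :=
  GRing.isZmodClosed.Build V (quot_pred subS) (GRing.submod_closedB subS).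

Definition lmod_quot : Type := Quotient.quot (quot_pred subS).

HB.instance Definition _ := GRing.Zmodule.on lmod_quot.

Definition quot_proj (x : V) : lmod_quot :=
  (\pi_(Quotient.quot (quot_pred subS)) x)%qT.

Definition quot_repr (q : lmod_quot) : V :=
  repr (q : Quotient.quot (quot_pred subS)).

Lemma quot_reprK : cancel quot_repr quot_proj.
Proof. exact: reprK. Qed.

Lemma quot_projE x y : quot_proj x = quot_proj y <-> x - y \in S.
Proof.
rewrite -/(quot_pred subS x) -[S]/(quot_pred subS) Quotient.idealrBE.
by split=> /eqP.
Qed.

Lemma quot_projD : {morph quot_proj : x y / x + y}.
Proof. by move=> x y; rewrite /quot_proj !piE. Qed.

Definition quot_scale (a : R) (q : lmod_quot) : lmod_quot :=
  quot_proj (a *: quot_repr q).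

Lemma quot_projZ a x : quot_proj (a *: x) = quot_scale a (quot_proj x).
Proof.
apply/quot_projE; rewrite -scalerBr.
have /quot_projE xS : quot_proj x = quot_proj (quot_repr (quot_proj x)).
  by rewrite quot_reprK.
by have := subS.2 a _ _ xS subS.1; rewrite addr0.
Qed.

Lemma quot_scaleA a b q :
  quot_scale a (quot_scale b q) = quot_scale (a * b) q.
Proof. by rewrite -(quot_reprK q) -!quot_projZ scalerA. Qed.

Lemma quot_scale1 : left_id 1 quot_scale.
Proof. by move=> q; rewrite -(quot_reprK q) -!quot_projZ scale1r. Qed.

Lemma quot_scaleDr : right_distributive quot_scale +%R.
Proof.
move=> a p q; rewrite -(quot_reprK p) -(quot_reprK q).
by rewrite -quot_projD -!quot_projZ -quot_projD scalerDr.
Qed.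

Lemma quot_scaleDl q : {morph quot_scale^~ q : a b / a + b}.
Proof.
by move=> a b; rewrite -(quot_reprK q) -!quot_projZ -quot_projD scalerDl.
Qed.

HB.instance Definition _ := GRing.Zmodule_isLmodule.Build R lmod_quot
  quot_scaleA quot_scale1 quot_scaleDr quot_scaleDl.

End Instances.

Definition finite_dimensional : Prop :=
  exists (n : nat) (e : 'I_n -> V), forall v, exists a : 'I_n -> R,
    v = \sum_(i < n) a i *: e i.

End QuotientModule.

Section Dual.
Variables (R : realType) (X : normedModType R).

Definition dual_pred : {pred X -> R^o} :=
  [pred f : X -> R^o | `[< linear f /\ continuous f >]].

Record dual := Dual { dual_fun :> X -> R^o ; _ : dual_fun \in dual_pred }.

HB.instance Definition _ := [isSub for dual_fun].
HB.instance Definition _ := [Choice of dual by <:].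

Lemma dual_submod_closed : submod_closed dual_pred.
Proof.
split=> [|a f g /asboolP[linf cf] /asboolP[ling cg]]; apply/asboolP; split.
- by move=> a x y; rewrite /= scaler0 addr0.
- exact: cst_continuous.
- move=> b x y /=; rewrite !fctE linf ling !scalerDr !scalerA mulrC.
  by rewrite addrACA.
- move=> x; apply: cvgD (cg x).
  exact: cvgZl_tmp (cf x).
Qed.

HB.instance Definition _ :=
  GRing.isSubmodClosed.Build _ _ dual_pred dual_submod_closed.
HB.instance Definition _ := [SubChoice_isSubLmodule of dual by <:].

Lemma dual_linear (f : dual) : linear (f : X -> R^o).
Proof. by case: f => f /= /asboolP[]. Qed.

HB.instance Definition _ (f : dual) :=
  GRing.isLinear.Build R X R^o *:%R (dual_fun f) (dual_linear f).

Lemma dual_continuous (f : dual) : continuous (f : X -> R^o).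
Proof. by case: f => f /= /asboolP[]. Qed.

Definition dual_norm (f : dual) : R :=
  sup [set `|f x| | x in [set x : X | `|x| <= 1]].

Lemma dual_norm_ubound (f : dual) :
  has_ubound [set `|f x| | x in [set x : X | `|x| <= 1]].
Proof.
have /linear_bounded_continuous/bounded_funP/(_ 1)[M fM] := @dual_continuous f.
by exists M => _ [x x1 <-]; exact: fM.
Qed.

Lemma dual_normP (f : dual) x : `|f x| <= dual_norm f * `|x|.
Proof.
have [->|x0] := eqVneq x 0; first by rewrite linear0 !normr0 mulr0.
rewrite -ler_pdivrMr ?normr_gt0//; apply: ub_le_sup.
  exact: dual_norm_ubound.
exists (`|x|^-1 *: x) => /=.
  by rewrite normrZ normfV normr_id mulVf ?normr_eq0.
by rewrite linearZ/= normrZ normfV normr_id mulrC.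
Qed.

Lemma dual_norm_le (f : dual) M :
  (forall x, `|x| <= 1 -> `|f x| <= M) -> dual_norm f <= M.
Proof.
move=> fM; apply: ge_sup; last by move=> _ [x x1 <-]; exact: fM.
by exists `|f 0|; exists 0; rewrite //= normr0.
Qed.

Lemma dual_norm_ge0 (f : dual) : 0 <= dual_norm f.
Proof.
apply: (@le_trans _ _ `|f 0|) => //; apply: ub_le_sup.
  exact: dual_norm_ubound.
by exists 0; rewrite //= normr0.
Qed.

Lemma dual_norm_unit (f : dual) x : `|x| <= 1 -> `|f x| <= dual_norm f.
Proof.
move=> x1; apply: le_trans (dual_normP f x) _.
by rewrite ler_piMr ?dual_norm_ge0.
Qed.

Lemma ler_dual_normD (f g : dual) :
  dual_norm (f + g) <= dual_norm f + dual_norm g.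
Proof.
apply: dual_norm_le => x x1.
by apply: le_trans (ler_normD _ _) _; rewrite lerD ?dual_norm_unit.
Qed.

Lemma dual_normZ a (f : dual) : dual_norm (a *: f) = `|a| * dual_norm f.
Proof.
have leZ b (g : dual) : dual_norm (b *: g) <= `|b| * dual_norm g.
  apply: dual_norm_le => x x1.
  by rewrite -[_ x]/(b * g x) normrM ler_wpM2l ?dual_norm_unit.
apply/eqP; rewrite eq_le leZ/=; have [->|a0] := eqVneq a 0.
  by rewrite normr0 mul0r dual_norm_ge0.
rewrite -ler_pdivlMl ?normr_gt0// -normfV.
by apply: le_trans (leZ _ _); rewrite scalerA mulVf// scale1r.
Qed.

Lemma dual_norm_eq0 (f : dual) : dual_norm f = 0 -> f = 0.
Proof.
move=> f0; apply/val_inj/funext => x /=.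
by apply/eqP; rewrite -normr_le0; have := dual_normP f x; rewrite f0 mul0r.
Qed.

HB.instance Definition _ := Lmodule_isNormed.Build R dual
  ler_dual_normD dual_normZ dual_norm_eq0.

End Dual.

Section Bidual.
Variables (R : realType) (X : normedModType R).

(* X^** is [dual (dual X)], and [bidual_embed] is the evaluation map X -> X^**. *)
Lemma bidual_embed_subproof (x : X) :
  ((fun f : dual X => f x) : dual X -> R^o) \in @dual_pred R (dual X).
Proof.
pose ev : dual X -> R^o := fun f => f x.
have evl : linear ev by [].
pose evL : {linear dual X -> R^o} :=
  HB.pack ev (GRing.isLinear.Build R (dual X) R^o *:%R ev evl).
apply/asboolP; split => //; apply/(@linear_bounded_continuous _ _ _ evL).
apply/linear_boundedP; near=> r => f; rewrite mulrC.
apply: le_trans (dual_normP f x) _; apply: ler_wpM2l.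
  exact: dual_norm_ge0.
by near: r; apply: nbhs_pinfty_ge; rewrite num_real.
Unshelve. all: by end_near. Qed.

Definition bidual_embed (x : X) : dual (dual X) := Dual (bidual_embed_subproof x).

Definition bidual_image : {pred dual (dual X)} :=
  [pred phi | `[< range bidual_embed phi >]].

Lemma bidual_image_submod : submod_closed bidual_image.
Proof.
split=> [|a _ _ /asboolP[x _ <-] /asboolP[y _ <-]]; apply/asboolP.
  by exists 0 => //; apply/val_inj/funext => f; exact: linear0.
by exists (a *: x + y) => //; apply/val_inj/funext => f; exact: linearP.
Qed.

Definition reflexive_space : Prop :=
  forall phi : dual (dual X), exists x, phi = bidual_embed x.

Definition quasi_reflexive : Prop :=
  finite_dimensional (lmod_quot bidual_image_submod).

End Bidual.

Section Ultrapower.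
Variables (R : realType) (X : normedModType R).

Section BoundedFamilies.
Variable I : Type.

Definition bounded_family_pred : {pred I -> X} :=
  [pred x : I -> X | `[< exists M, forall i, `|x i| <= M >]].

Record bounded_family :=
  BoundedFamily { family_fun :> I -> X ; _ : family_fun \in bounded_family_pred }.

HB.instance Definition _ := [isSub for family_fun].
HB.instance Definition _ := [Choice of bounded_family by <:].

Lemma bounded_family_submod_closed : submod_closed bounded_family_pred.
Proof.
split=> [|a x y /asboolP[M xM] /asboolP[N yN]]; apply/asboolP.
  by exists 0 => i /=; rewrite normr0.
exists (`|a| * M + N) => i /=; apply: le_trans (ler_normD _ _) _.
by rewrite lerD// normrZ ler_wpM2l.
Qed.

HB.instance Definition _ :=
  GRing.isSubmodClosed.Build _ _ bounded_family_pred
    bounded_family_submod_closed.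
HB.instance Definition _ := [SubChoice_isSubLmodule of bounded_family by <:].

End BoundedFamilies.

Variables (I : Type) (U : set_system I) (ultraU : UltraFilter U).

Definition null_family : {pred bounded_family I} :=
  [pred x : bounded_family I | `[< x i @[i --> U] --> (0 : X) >]].

Lemma null_family_submod_closed : submod_closed null_family.
Proof.
split=> [|a x y /asboolP x0 /asboolP y0]; apply/asboolP.
  exact: cvg_cst.
rewrite -[0](addr0 0) -{1}(scaler0 _ a).
by apply: cvgD => //; exact: cvgZl_tmp.
Qed.

(* The space l_oo(I, X) modulo the families tending to 0 along [U], with the
   norm lim_U |x_i| (computed on a representative, see
   [ultrapower_norm_proj]). *)
Definition ultrapower : Type := lmod_quot null_family_submod_closed.

HB.instance Definition _ := GRing.Lmodule.on ultrapower.

Definition family_ultranorm (x : bounded_family I) : R :=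
  lim (`|x i| @[i --> U]).

Definition ultrapower_norm (q : ultrapower) : R :=
  family_ultranorm (quot_repr q).

Lemma family_ultranorm_cvg (x : bounded_family I) :
  `|x i| @[i --> U] --> family_ultranorm x.
Proof.
pose F := `|x i| @[i --> U]; have UF : UltraFilter F.
  split=> [|G PG FG]; first exact: fmap_proper_filter.
  apply/seteqP; split=> // A GA; rewrite /F nbhs_simpl.
  have [//|nA] := in_ultra_setVsetC ((fun i => `|x i|) @^-1` A) ultraU.
  have /filter_ex[y [] //] : G (A `&` ~` A) by apply: filterI => //; exact: FG.
have [M xM] : exists M, forall i, `|x i| <= M by case: x {F UF} => x /= /asboolP.
have := @segment_compact R 0 M; rewrite compact_ultra => /(_ F UF)[|p [_ Fp]].
  rewrite /F nbhs_simpl; apply: (@filterE _ U) => i /=.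
  by rewrite in_itv/= normr_ge0 xM.
by apply: cvgP Fp.
Qed.

Lemma ultrapower_norm_proj (x : bounded_family I) :
  ultrapower_norm (quot_proj null_family_submod_closed x) = family_ultranorm x.
Proof.
set y := quot_repr (quot_proj null_family_submod_closed x).
have /quot_projE/asboolP xy0 : quot_proj null_family_submod_closed x =
    quot_proj null_family_submod_closed y by rewrite quot_reprK.
have n0 : `|x i - y i| @[i --> U] --> 0.
  by rewrite -(@normr0 _ X); exact: cvg_norm xy0.
rewrite /ultrapower_norm -/y; apply: cvg_lim; first exact: norm_hausdorff.
have d0 : (`|y i| - `|x i|) @[i --> U] --> (0 : R).
  apply: (@squeeze_cvgr _ _ _ _ (fun i => - `|x i - y i|)
    (fun i => `|x i - y i|)) => //.
  - by apply: nearW => i; rewrite -ler_norml distrC ler_dist_dist.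
  - by rewrite -[0]oppr0; exact: cvgN.
have := cvgD d0 (@family_ultranorm_cvg x).
rewrite add0r => /(_ _) h; apply: (cvg_trans _ h); apply: near_eq_cvg.
by apply: nearW => i; exact: subrK.
Qed.

Lemma ler_ultrapower_normD (p q : ultrapower) :
  ultrapower_norm (p + q) <= ultrapower_norm p + ultrapower_norm q.
Proof.
rewrite -(quot_reprK p) -(quot_reprK q) -quot_projD !ultrapower_norm_proj.
set x := quot_repr p; set y := quot_repr q.
have xyD := @cvgD _ _ _ _ _ _ _ _ _ (@family_ultranorm_cvg x)
  (@family_ultranorm_cvg y).
have h := @cvgB _ _ _ _ _ _ _ _ _ (xyD _) (@family_ultranorm_cvg (x + y)).
rewrite -subr_ge0; apply: (cvgr_to_ge (h _ _)).
by apply: (@filterE _ U) => i; rewrite subr_ge0; exact: ler_normD.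
Qed.

Lemma ultrapower_normZ a (q : ultrapower) :
  ultrapower_norm (a *: q) = `|a| * ultrapower_norm q.
Proof.
rewrite -(quot_reprK q) -[a *: _]quot_projZ !ultrapower_norm_proj.
set x := quot_repr q; apply: cvg_lim; first exact: norm_hausdorff.
rewrite (_ : (fun i => _) = (fun i => `|a| * `|x i|)).
  exact: cvgZl_tmp (@family_ultranorm_cvg x).
by apply/funext => i; rewrite -normrZ.
Qed.

Lemma ultrapower_norm_eq0 (q : ultrapower) : ultrapower_norm q = 0 -> q = 0.
Proof.
rewrite -(quot_reprK q) ultrapower_norm_proj => q0.
have <- : quot_proj null_family_submod_closed 0 = 0 by rewrite /quot_proj piE.
apply/quot_projE; rewrite subr0; apply/asboolP/norm_cvg0P.
by rewrite -q0; exact: family_ultranorm_cvg.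
Qed.

HB.instance Definition _ := Lmodule_isNormed.Build R ultrapower
  ler_ultrapower_normD ultrapower_normZ ultrapower_norm_eq0.

End Ultrapower.

Definition super_reflexive (R : realType) (X : normedModType R) : Prop :=
  forall (I : Type) (U : set_system I) (ultraU : UltraFilter U),
    reflexive_space (ultrapower X ultraU).

Section WeaklyLindelofDetermined.

(* [h] and [g] are total functions of which only the restrictions to [A] and
   [B] matter. *)
Definition homeomorphic_subsets {S T : topologicalType} (A : set S) (B : set T)
    : Prop :=
  exists (h : S -> T) (g : T -> S),
    [/\ h @` A = B, {in A, cancel h g},
        {within A, continuous h} & {within B, continuous g}].

Definition weak_star (R : realType) (X : normedModType R) : Type :=
  initial_topology (fun f : dual X => (f : {ptws X -> R})).

HB.instance Definition _ (R : realType) (X : normedModType R) :=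
  Topological.on (weak_star X).

Definition closed_unit_ball (R : realType) (X : normedModType R) : set X :=
  [set x | `|x| <= 1].
Arguments closed_unit_ball {R} X _.

Definition sigma_product (R : realType) (Gamma : Type) : set (Gamma -> R) :=
  [set x | countable [set gamma | x gamma != 0]].
Arguments sigma_product R Gamma _ : clear implicits.

Definition weakly_Lindelof_determined (R : realType) (X : normedModType R)
    : Prop :=
  exists (Gamma : Type) (S : set {ptws Gamma -> R}),
    [/\ S `<=` sigma_product R Gamma, compact S &
        homeomorphic_subsets (closed_unit_ball (dual X) : set (weak_star X)) S].

End WeaklyLindelofDetermined.

Section Separation.
Variables (R : realType) (X : normedModType R).

Definition unit_sphere : set X := [set x | `|x| = 1].

Definition one_plus_separated (A : set X) : Prop :=
  forall x y, A x -> A y -> x <> y -> 1 < `|x - y|.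

Definition delta_separated (delta : R) (A : set X) : Prop :=
  forall x y, A x -> A y -> x <> y -> delta <= `|x - y|.

Definition density : set X := min_card (@dense X).

Definition separable_space : Prop := exists2 A : set X, countable A & dense A.

End Separation.

Arguments unit_sphere {R} X _.
Arguments density {R} X _.

(* Main.v *)
(* Call x, of norm 1, isolated by a set F of functionals if |x - z| > 1 for all
   unit vectors z killed by F. Consider families of pairs (x, F) with F countable
   and x isolated by the union of the F's, whose vectors are pairwise at distance
   more than 1. Zorn's lemma yields a maximal one, which cannot be small provided
   that, for every small set G, some unit vector killed by G is isolated by the
   union of G and a countable set.

   In a quasi-reflexive space such a vector exists, even with a uniform gap:
   otherwise one could keep adding unit-size vectors, each killed by functionals
   norming the span of the previous ones, to finitely many partial sums without
   making these unbounded; weak* cluster points of more partial sums than the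
   dimension of X**/X have a nontrivial combination in X, and the projections
   onto initial spans show that this is absurd. As super-reflexive spaces are
   reflexive, (ii) follows by a pigeonhole argument on the size of the gap.

   In the dual of a WLD space, with vectors of X playing the role of functionals,
   the same procedure is continued transfinitely, taking weak* limits. The limit
   functionals have countable support in a Sigma-product, and each step enlarges
   that support, so that the process is always of countable cofinality and never
   stops, contradicting Zorn's lemma. *)
From HB Require Import structures.
Require Import Defs.
From mathcomp Require Import all_boot all_order all_algebra.
From mathcomp Require Import all_classical all_reals all_analysis.
From mathcomp Require Import lra.

Set Implicit Arguments.
Unset Strict Implicit.
Unset Printing Implicit Defensive.

Import Order.TTheory GRing.Theory Num.Theory.
Import numFieldNormedType.Exports.

Local Open Scope classical_set_scope.
Local Open Scope ring_scope.
Local Open Scope card_scope.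

(** * The Hahn-Banach theorem *)

Section HahnBanach.
Variables (R : realType) (V : lmodType R).
Implicit Types (p q : V -> R) (x y v : V).

(** Positive multiples only need an upper bound; the reverse one follows by scaling back with
    [a^-1]. *)
Definition sublinear p : Prop :=
  (forall x y, p (x + y) <= p x + p y) /\
  (forall a x, 0 < a -> p (a *: x) <= a * p x).

Lemma sublinearZ p a x : sublinear p -> 0 < a -> p (a *: x) = a * p x.
Proof.
move=> [_ pZ] a0; apply/eqP; rewrite eq_le pZ//= -ler_pdivlMl//.
by rewrite -{1}(scale1r x) -(mulVf (lt0r_neq0 a0)) -scalerA pZ ?invr_gt0.
Qed.

Lemma sublinear0 p : sublinear p -> p 0 = 0.
Proof.
move=> /sublinearZ -/(_ 2 0 (ltr0Sn _ _)); rewrite scaler0 => e.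
by lra.
Qed.

Lemma sublinear_ge p x : sublinear p -> - p (- x) <= p x.
Proof.
move=> sp; have := sp.1 x (- x); rewrite subrr sublinear0// => ?.
by lra.
Qed.

(** The [q i] need not be sublinear one by one: the index may change in both inequalities, and [l]
    keeps the infimum finite. This serves for shrinking, for chains and for the distance to a
    span. *)
Lemma sublinear_inf (I : Type) (A : set I) (q : I -> V -> R) (l : V -> R) :
    A !=set0 -> (forall i x, A i -> l x <= q i x) ->
    (forall i j x y, A i -> A j ->
       exists2 k, A k & q k (x + y) <= q i x + q j y) ->
    (forall i a x, A i -> 0 < a ->
       exists2 k, A k & q k (a *: x) <= a * q i x) ->
  sublinear (fun x => inf [set q i x | i in A]).
Proof.
move=> [i0 Ai0] lq qD qZ.
have lb x : has_lbound [set q i x | i in A].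
  by exists (l x) => _ [i Ai <-]; exact: lq.
have ne x : [set q i x | i in A] !=set0 by exists (q i0 x), i0.
split=> [x y|a x a0].
  rewrite -lerBlDr; apply: lb_le_inf => // _ [i Ai <-].
  rewrite lerBlDr -lerBlDl; apply: lb_le_inf => // _ [j Aj <-].
  rewrite lerBlDl; have [k Ak] := qD i j x y Ai Aj; apply: le_trans.
  by apply: ge_inf => //; exists k.
rewrite -ler_pdivrMl//; apply: lb_le_inf => // _ [i Ai <-].
rewrite ler_pdivrMl//; have [k Ak] := qZ i a x Ai a0; apply: le_trans.
by apply: ge_inf => //; exists k.
Qed.

(** Take the infimum over t >= 0 of q(x + t v) - t q(v): t = 0 gives p <= q, and t = 1 gives the
    bound at -v. *)
Lemma sublinear_shrink q v : sublinear q ->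
  exists2 p, sublinear p & (forall x, p x <= q x) /\ p (- v) <= - q v.
Proof.
move=> sq; pose r (t : R) x := q (x + t *: v) - t * q v.
have q0 := sublinear0 sq.
have lr t x : 0 <= t -> - q (- x) <= r t x.
  rewrite le_eqVlt => /predU1P[<-|t0].
    by rewrite /r scale0r addr0 mul0r subr0 sublinear_ge.
  have := sq.1 (- x) (x + t *: v); rewrite addKr sublinearZ// /r => ?.
  by lra.
exists (fun x => inf [set r t x | t in [set t | 0 <= t]]).
  apply: (@sublinear_inf _ _ _ (fun x => - q (- x))).
  - by exists 0 => /=.
  - by move=> t x; exact: lr.
  - move=> s t x y /= s0 t0; exists (s + t); first exact: addr_ge0.
    have := sq.1 (x + s *: v) (y + t *: v).
    by rewrite addrACA -scalerDl /r => ?; lra.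
  - move=> t a x /= t0 a0; exists (a * t); first by rewrite mulr_ge0 // ltW.
    by rewrite /r -scalerA -scalerDr sublinearZ// mulrBr mulrA.
have ub t x : 0 <= t -> inf [set r t x | t in [set t | 0 <= t]] <= r t x.
  move=> t0; apply: ge_inf; last by exists t.
  by exists (- q (- x)) => _ [s /= s0 <-]; exact: lr.
split=> [x|].
  by apply: le_trans (ub 0 x _) _; rewrite // /r scale0r addr0 mul0r subr0.
apply: le_trans (ub 1 _ _) _; first exact: ler01.
by rewrite /r scale1r addNr q0 mul1r sub0r.
Qed.

(* A minimal sublinear functional is odd, by [sublinear_shrink], hence linear. *)
Lemma sublinear_linear p : sublinear p ->
  exists2 f : V -> R^o, linear f & forall x, f x <= p x.
Proof.
move=> sp; pose S := {q : V -> R | sublinear q /\ forall x, q x <= p x}.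
(* The order is reversed, so that a maximal element is a pointwise minimal functional. *)
pose le (q1 q2 : S) := `[< forall x, sval q2 x <= sval q1 x >].
have [q0|q1 q2 q3|[q1 P1] [q2 P2]|A Atot|[q [sq qp]] qmin] := @Zorn S le.
- exact/asboolP.
- move=> /asboolP h12 /asboolP h23; apply/asboolP => x.
  exact: le_trans (h23 x) (h12 x).
- move=> /asboolP h12 /asboolP h21; apply: eq_exist.
  by apply/funext => x; apply/eqP; rewrite eq_le h12 h21.
- have [->|/set0P A0] := eqVneq A set0.
    by exists (exist _ p (conj sp (fun x => lexx (p x)))).
  pose qi x := inf [set sval q x | q in A].
  have lq (q : S) x : A q -> - p (- x) <= sval q x.
    case: q => q [sq qp] /= _; apply: le_trans (sublinear_ge x sq).
    by rewrite lerN2.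
  have sqi : sublinear qi.
    apply: (@sublinear_inf _ _ _ (fun x => - p (- x))) => //.
    - move=> q1 q2 x y A1 A2; have [/asboolP h|/asboolP h] := Atot _ _ A1 A2.
        exists q2 => //; apply: le_trans ((proj2_sig q2).1.1 x y) _.
        by rewrite lerD2r.
      exists q1 => //; apply: le_trans ((proj2_sig q1).1.1 x y) _.
      by rewrite lerD2l.
    - by move=> q a x Aq a0; exists q => //; exact: (proj2_sig q).1.2.
  have qiq (q : S) x : A q -> qi x <= sval q x.
    move=> Aq; apply: ge_inf; last by exists q.
    by exists (- p (- x)) => _ [q' Aq' <-]; exact: lq.
  have qip x : qi x <= p x.
    by have [q Aq] := A0; apply: le_trans (qiq q x Aq) ((proj2_sig q).2 x).
  exists (exist _ qi (conj sqi qip)) => q Aq; apply/asboolP => x /=.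
  exact: qiq.
have odd v : q (- v) = - q v.
  have [r sr [rq rv]] := sublinear_shrink v sq.
  have rp x : r x <= p x by apply: le_trans (rq x) (qp x).
  have rq' : le (exist _ q (conj sq qp)) (exist _ r (conj sr rp)) by exact/asboolP.
  have /= e := congr1 sval (qmin _ rq').
  apply/eqP; rewrite eq_le -{1}e/= rv/=.
  by rewrite lerNl; exact: sublinear_ge.
have qD x y : q (x + y) = q x + q y.
  apply/eqP; rewrite eq_le sq.1/=; have := sq.1 (- x) (- y).
  by rewrite -opprD !odd => ?; lra.
exists q => // a x y; rewrite qD; congr (_ + _).
have [a0|a0|->] := ltgtP a 0.
- rewrite -[in LHS](opprK a) scaleNr odd sublinearZ ?oppr_gt0//.
  by rewrite mulNr opprK.
- exact: sublinearZ.
- by rewrite !scale0r sublinear0.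
Qed.

(** Shrinking [p] at [v] first makes every linear [f] below the result satisfy f(-v) <= -p(v). *)
Lemma hahn_banach p v : sublinear p ->
  exists2 f : V -> R^o, linear f & (forall x, f x <= p x) /\ f v = p v.
Proof.
move=> sp; have [r sr [rp rv]] := sublinear_shrink v sp.
have [f lf fr] := sublinear_linear sr; exists f => //.
have fp x : f x <= p x by apply: le_trans (fr x) (rp x).
split=> //; apply/eqP; rewrite eq_le fp/=.
have fN : f (- v) = - f v.
  pose fL : {linear V -> R^o} := HB.pack f (GRing.isLinear.Build R V R^o *:%R f lf).
  exact: (linearN fL).
by have := le_trans (fr (- v)) rv; rewrite fN lerN2.
Qed.

End HahnBanach.

(** * The dual space and rational spans *)

Section DualSpace.
Variables (R : realType) (X : normedModType R).
Implicit Types (x y : X) (f : dual X).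

Lemma dualD (f g : dual X) x : (f + g) x = f x + g x. Proof. by []. Qed.

Lemma dualZ a f x : (a *: f) x = a * f x. Proof. by []. Qed.

Lemma dualB (f g : dual X) x : (f - g) x = f x - g x. Proof. by []. Qed.

Lemma dual_sum (I : Type) (r : seq I) (P : pred I) (F : I -> dual X) x :
  (\sum_(i <- r | P i) F i) x = \sum_(i <- r | P i) F i x.
Proof. by apply: (big_morph (fun f : dual X => f x)). Qed.

Lemma dual_ext (f g : dual X) : (forall x, f x = g x) -> f = g.
Proof. by move=> fg; apply/val_inj/funext. Qed.

Lemma ler_dual f x : `|f x| <= `|f| * `|x|.
Proof. exact: dual_normP. Qed.

Lemma dual_of_bounded (f : X -> R^o) (M : R) : linear f -> 0 <= M ->
  (forall x, `|f x| <= M * `|x|) ->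
  exists2 g : dual X, (forall x, g x = f x) & `|g| <= M.
Proof.
move=> lf M0 fM.
pose fL : {linear X -> R^o} := HB.pack f (GRing.isLinear.Build R X R^o *:%R f lf).
have fP : f \in @dual_pred R X.
  apply/asboolP; split=> //; apply/(@linear_bounded_continuous _ _ _ fL).
  apply/linear_boundedP; near=> r => x; apply: le_trans (fM x) _.
  apply: ler_wpM2r => //; near: r; apply: nbhs_pinfty_ge; exact: num_real.
exists (Dual fP) => //; apply: dual_norm_le => x x1 /=.
by apply: le_trans (fM x) _; rewrite ler_piMr.
Unshelve. all: by end_near. Qed.

Lemma sublinear_norm : @sublinear R X (fun x => `|x|).
Proof.
split=> [x y|a x a0]; first exact: ler_normD.
by rewrite normrZ gtr0_norm.
Qed.

Lemma dual_le_norm (f : X -> R^o) : linear f -> (forall x, f x <= `|x|) ->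
  exists2 g : dual X, (forall x, g x = f x) & `|g| <= 1.
Proof.
move=> lf fx; apply: (dual_of_bounded lf) => // x.
pose fL : {linear X -> R^o} := HB.pack f (GRing.isLinear.Build R X R^o *:%R f lf).
have fN : f (- x) = - f x by exact: (linearN fL).
by rewrite mul1r ler_norml fx andbT lerNl -fN -(normrN x) fx.
Qed.

Lemma norming x : exists2 f : dual X, `|f| <= 1 & f x = `|x|.
Proof.
have [f lf [fle fx]] := hahn_banach x sublinear_norm.
by have [g gf g1] := dual_le_norm lf fle; exists g => //; rewrite gf.
Qed.

Lemma dual_unit_le f x : `|f| <= 1 -> f x <= `|x|.
Proof.
move=> f1; apply: le_trans (ler_norm _) _; apply: le_trans (ler_dual f x) _.
by rewrite ler_piMl.
Qed.

Section RationalSpan.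
Variables (I : Type) (e : I -> X).

(** Lists with rational coefficients keep the number of combinations under control: it is countable
    for countable [I], and [embeds_seq] handles larger [I]. *)
Definition ratcomb (l : seq (rat * I)) : X := \sum_(p <- l) ratr p.1 *: e p.2.

Lemma ratcomb_dense_realcomb (l : seq (R * I)) d : 0 < d ->
  exists2 l' : seq (rat * I), map snd l' = map snd l &
    `|(\sum_(p <- l) p.1 *: e p.2) - ratcomb l'| < d.
Proof.
elim: l d => [|[a i] l IH] d d0.
  by exists [::] => //; rewrite /ratcomb !big_nil subrr normr0.
have d2 : 0 < d / 2 by rewrite divr_gt0.
have [l' ll' dl'] := IH _ d2.
have c0 : 0 < d / 2 / (`|e i| + 1).
  by rewrite divr_gt0// ltr_wpDl.
have [q /[!in_itv]/= /andP[q1 q2]] : exists q : rat,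
    ratr q \in `]a - d / 2 / (`|e i| + 1), a[.
  by have [q] := @rat_in_itvoo R (a - d / 2 / (`|e i| + 1)) a (ltac:(lra));
     exists q.
exists ((q, i) :: l'); first by rewrite /= ll'.
rewrite /ratcomb !big_cons/= opprD addrACA -scalerBl [ltRHS]splitr.
apply: le_lt_trans (ler_normD _ _) _; rewrite ler_ltD// normrZ gtr0_norm ?subr_gt0//.
have n0 : 0 < `|e i| + 1 by rewrite ltr_wpDl.
rewrite -[leRHS](divfK (lt0r_neq0 n0)); apply: ler_pM => //; first lra.
  lra.
by rewrite lerDl.
Qed.

Let realcomb (l : seq (R * I)) : X := \sum_(p <- l) p.1 *: e p.2.

Lemma sublinear_dist : sublinear (fun x =>
  inf [set `|x - realcomb l| | l in [set: seq (R * I)]]).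
Proof.
apply: (@sublinear_inf _ _ _ setT (fun l x => `|x - realcomb l|) (fun=> 0)).
- by exists [::].
- by move=> *; exact: normr_ge0.
- move=> l1 l2 x y _ _; exists (l1 ++ l2) => //.
  by rewrite /realcomb big_cat opprD addrACA; exact: ler_normD.
- move=> l a x _ a0; exists [seq (a * p.1, p.2) | p <- l] => //.
  rewrite /realcomb big_map/=.
  under eq_bigr do rewrite -scalerA.
  by rewrite -scaler_sumr -scalerBr normrZ gtr0_norm.
Qed.

(** Hahn-Banach, applied to the distance to the span, gives [f] equal to that distance at [y] and
    vanishing on every [e i]; so the distance is 0. *)
Lemma ratcomb_approx y : (forall f, (forall i, f (e i) = 0) -> f y = 0) ->
  forall d, 0 < d -> exists l, `|y - ratcomb l| < d.
Proof.
move=> sep d d0; pose dist x := inf [set `|x - realcomb l| | l in [set: seq (R * I)]].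
have dist_le x l : dist x <= `|x - realcomb l|.
  by apply: ge_inf; [exists 0 => _ [? _ <-]; exact: normr_ge0|exists l].
have [f lf [fle fy]] := hahn_banach y sublinear_dist.
have fnorm x : f x <= `|x|.
  apply: le_trans (fle x) _; apply: le_trans (dist_le x [::]) _.
  by rewrite /realcomb big_nil subr0.
have [g gf _] := dual_le_norm lf fnorm.
have ge i : g (e i) = 0.
  have le0 t : g (t *: e i) <= 0.
    rewrite gf; apply: le_trans (fle _) _; apply: le_trans (dist_le _ [:: (t, i)]) _.
    by rewrite /realcomb big_seq1 subrr normr0.
  apply/eqP; rewrite eq_le -[X in g X]scale1r le0 scale1r/=.
  by have := le0 (-1); rewrite scaleN1r linearN oppr_le0.
have y0 : dist y < d / 2 by rewrite /dist -fy -gf sep// divr_gt0.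
have [_ [l _ <-] yl] : exists2 r, [set `|y - realcomb l| | l in [set: seq (R * I)]] r
    & r < d / 2.
  by apply: inf_lt => //; exists (`|y - realcomb [::]|), [::].
have [l' _ ll'] := ratcomb_dense_realcomb l (divr_gt0 d0 (ltr0Sn R 1)).
exists l'; rewrite -(subrKA (realcomb l)) [ltRHS]splitr.
by apply: le_lt_trans (ler_normD _ _) _; exact: ltrD.
Qed.

Lemma ratcomb_dense :
  (forall f, (forall i, f (e i) = 0) -> f = 0) -> dense (range ratcomb).
Proof.
move=> sep O [y Oy] oO.
have /nbhs_ballP[d /= d0 dO] : nbhs y O by exact: open_nbhs_nbhs.
have [f /sep-> //|l yl] := ratcomb_approx (y := y) _ d0.
exists (ratcomb l); split; last by exists l.
by apply: dO; rewrite -ball_normE.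
Qed.

End RationalSpan.
End DualSpace.

(** * Ultralimits of functionals and quasi-reflexivity *)

Section Ultralimits.
Variables (R : realType) (I : Type) (U : set_system I) (UU : UltraFilter U).

Lemma ultra_fmap (T : Type) (f : I -> T) : UltraFilter (f @ U).
Proof.
split=> [|G PG FG]; first exact: fmap_proper_filter.
apply/seteqP; split=> // A GA.
have [//|nA] := in_ultra_setVsetC (f @^-1` A) UU.
have /filter_ex[y [] //] : G (A `&` ~` A) by apply: filterI => //; exact: FG.
Qed.

Lemma ultra_bounded_cvg (u : I -> R) (M : R) :
  (forall i, `|u i| <= M) -> exists l : R, u i @[i --> U] --> l.
Proof.
move=> uM; have UF : UltraFilter (u @ U) by exact: ultra_fmap.
have := @segment_compact R (- M) M; rewrite compact_ultra => /(_ _ UF)[|l [_ ul]].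
  by rewrite nbhs_simpl; apply: (@filterE _ U) => i /=; rewrite in_itv/= -ler_norml.
by exists l.
Qed.

(** Banach-Alaoglu along an ultrafilter: bounded values converge pointwise, and linearity and the
    bound pass to the limit. *)
Lemma dual_ultralimit (X : normedModType R) (F : I -> dual X) (M : R) :
  (forall i, `|F i| <= M) ->
  exists2 phi : dual X, `|phi| <= M & forall x, F i x @[i --> U] --> phi x.
Proof.
move=> FM; have FxM i x : `|F i x| <= M * `|x|.
  by apply: le_trans (ler_dual _ _) _; rewrite ler_wpM2r.
have /choice[phi phiE] : forall x, exists l : R, F i x @[i --> U] --> l.
  by move=> x; exact: (ultra_bounded_cvg (fun i => FxM i x)).
have M0 : 0 <= M.
  by have [i _] := @filter_ex _ U _ setT filterT; exact: le_trans (FM i).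
have lphi : linear (phi : X -> R^o).
  move=> a x y; apply: (@cvg_unique _ (@norm_hausdorff _ R^o) (F i (a *: x + y) @[i --> U])).
    exact: phiE.
  rewrite (_ : (fun i => F i (a *: x + y)) = (fun i => (a *: (F i x : R^o) + F i y))).
    by apply: cvgD => //; exact: cvgZl_tmp.
  by apply/funext => i; exact: dual_linear.
have phiM x : `|phi x| <= M * `|x|.
  have h : `|F i x| @[i --> U] --> `|phi x| by exact: cvg_norm (phiE x).
  by apply: (cvgr_to_le h); apply: nearW => i; exact: FxM.
by have [g gE gM] := dual_of_bounded lphi M0 phiM; exists g => // x; rewrite gE.
Qed.

End Ultralimits.

(** * Linear dependence in the bidual modulo X *)

Section QuasiReflexive.
Variables (R : realType) (X : normedModType R).

Lemma bidual_norm (x : X) : `|bidual_embed x| <= `|x|.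
Proof.
by apply: dual_norm_le => f f1; rewrite (le_trans (ler_dual f x))// ler_piMl.
Qed.

(** The classes of n + 1 elements in a quotient spanned by n vectors are dependent; [c] is a nonzero
    row in the kernel of their coefficient matrix. *)
Lemma quasi_reflexive_dependence : quasi_reflexive X ->
  exists n, forall phi : 'I_n.+1 -> dual (dual X),
    exists2 c : 'I_n.+1 -> R, (exists i, c i != 0) &
      exists x, \sum_i c i *: phi i = bidual_embed x.
Proof.
move=> [n [e eP]]; exists n => phi.
set pr := quot_proj (bidual_image_submod X).
have /choice[a aP] i := eP (pr (phi i)).
pose A := \matrix_(i, j) a i j.
have /rowV0Pn[c /sub_kermxP cA c0] : kermx A != 0.
  by rewrite kermx_eq0 /row_free neq_ltn ltnS rank_leq_col.
exists (c 0).
  apply: contrapT => nc; case/eqP: c0; apply/rowP => i; rewrite mxE.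
  by apply/eqP; apply/negP => /negP ci; apply: nc; exists i.
have : pr (\sum_i c 0 i *: phi i) = pr 0.
  have prD : {morph pr : x y / x + y} by exact: quot_projD.
  have prZ r x : pr (r *: x) = r *: pr x by exact: quot_projZ.
  have pr0 : pr 0 = 0 by rewrite /pr /quot_proj piE.
  rewrite pr0 (big_morph pr prD pr0).
  under eq_bigr do rewrite prZ aP scaler_sumr.
  rewrite exchange_big/= big1// => j _.
  under eq_bigr do rewrite scalerA.
  rewrite -scaler_suml.
  move/rowP/(_ j): cA; rewrite !mxE => cA.
  have -> : \sum_i c 0 i * a i j = 0.
    by rewrite -[RHS]cA; apply: eq_bigr => i _; rewrite mxE.
  by rewrite scale0r.
by move/quot_projE; rewrite subr0 => /asboolP[x _ <-]; exists x.
Qed.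

Lemma reflexive_quasi_reflexive : reflexive_space X -> quasi_reflexive X.
Proof.
move=> rX; exists 0%N, (fun=> 0) => v; exists (fun=> 0); rewrite big_ord0.
rewrite -(quot_reprK v); have <- : quot_proj (bidual_image_submod X) 0 = 0.
  by rewrite /quot_proj piE.
apply/quot_projE; rewrite subr0; apply/asboolP.
by have [x ->] := rX (quot_repr v); exists x.
Qed.

End QuasiReflexive.

(** * A vector isolated from the kernel of countably many functionals *)

Section SeparatedPoint.
Variables (R : realType) (X : normedModType R).

Definition annihilator (G : set (dual X)) : set X :=
  [set x | forall f, G f -> f x = 0].

Lemma annihilatorU G F x :
  annihilator (G `|` F) x <-> annihilator G x /\ annihilator F x.
Proof.
split=> [h|[hG hF] f [/hG|/hF]//].
by split=> f ?; apply: h; [left|right].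
Qed.

Lemma annihilatorZ G a x : annihilator G x -> annihilator G (a *: x).
Proof. by move=> Gx f Gf; rewrite linearZ/= Gx// scaler0. Qed.

Lemma annihilator_sum G (I : Type) (r : seq I) (P : pred I) (u : I -> X) :
  (forall i, P i -> annihilator G (u i)) ->
  annihilator G (\sum_(i <- r | P i) u i).
Proof. by move=> Gu f Gf; rewrite linear_sum big1// => i Pi; exact: Gu. Qed.

Lemma strong_recursion (T : Type) (P : seq T -> T -> Prop) :
  (forall l, exists v, P l v) ->
  exists w : nat -> T, forall k, P (mkseq w k) (w k).
Proof.
move=> /choice[nx nxP]; pose L := fix L k := if k is k'.+1 then rcons (L k') (nx (L k')) else [::].
exists (fun k => nx (L k)) => k.
suff -> : mkseq (fun k => nx (L k)) k = L k by exact: nxP.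
by elim: k => //= k IH; rewrite mkseqS IH.
Qed.

Definition locally_separated (G : set (dual X)) (x : X) (F : set (dual X)) (eps : R) :=
  forall z, `|z| = 1 -> annihilator (G `|` F) z -> 1 + eps <= `|x - z|.

Section BlockSums.
Variables (n : nat) (w : nat -> X).

(* All blocks share the initial term [w 0]. *)
Definition in_block (i : 'I_n.+1) (j : nat) : bool :=
  (j == 0%N) || (j %% n.+1 == i)%N.

Definition block_sum (i : 'I_n.+1) (k : nat) : X :=
  \sum_(j < k | in_block i j) w j.

Lemma block_sumS i k : block_sum i k.+1 =
  block_sum i k + (if in_block i k then w k else 0).
Proof. by rewrite /block_sum big_mkcond big_ord_recr/= -big_mkcond. Qed.

Lemma block_sum_stable (f : dual X) i m k :
  (forall j, (m <= j)%N -> f (w j) = 0) -> (m <= k)%N ->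
  f (block_sum i k) = f (block_sum i m).
Proof.
move=> f0 mk; rewrite -(subnKC mk); elim: (k - m)%N => [|d IH].
  by rewrite addn0.
rewrite addnS block_sumS linearD/= IH; case: ifP => _; rewrite ?linear0 ?addr0//.
by rewrite f0 ?leq_addr// addr0.
Qed.

End BlockSums.

Lemma eq_block_sum n (w w' : nat -> X) (i : 'I_n.+1) k :
  (forall j, (j < k)%N -> w j = w' j) -> block_sum w i k = block_sum w' i k.
Proof. by move=> ww'; apply: eq_bigr => j _; exact: ww'. Qed.

(* Otherwise one builds [w] such that all the [block_sum w i] stay bounded,
   every [w k] being killed by norming functionals of the rational span of its
   predecessors. If [t k] is a combination of block sums whose limit in the
   bidual is some [y] in X, those functionals evaluate equally at [y] and at
   [t k], so that [t k] is Cauchy up to small errors, against [1 <= `|w k|]. *)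
Lemma exists_locally_separated (G : set (dual X)) : quasi_reflexive X ->
    (forall F, countable F -> exists2 z, `|z| = 1 & annihilator (G `|` F) z) ->
  exists x F (eps : R), [/\ `|x| = 1, annihilator G x, countable F, 0 < eps &
    locally_separated G x F eps].
Proof.
move=> /quasi_reflexive_dependence[n dep] Gbig.
apply: contrapT => nex.
have bad x F (eps : R) : `|x| = 1 -> annihilator G x -> countable F -> 0 < eps ->
    exists z, [/\ `|z| = 1, annihilator (G `|` F) z & `|x - z| < 1 + eps].
  move=> x1 Gx cF eps0; apply: contrapT => nz; apply: nex; exists x, F, eps.
  split=> // z z1 Fz; rewrite leNgt; apply/negP => xz; apply: nz.
  by exists z.
have [x0 x01 /annihilatorU[Gx0 _]] := Gbig _ (countable0 _).
have /choice[J JP] : forall x, exists f : dual X, `|f| <= 1 /\ f x = `|x|.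
  by move=> x; have [f] := norming x; exists f.
pose Fl (l : seq X) := range (fun q : seq (rat * nat) => J (ratcomb (nth 0 l) q)).
pose ord k : 'I_n.+1 := inord (k %% n.+1)%N.
pose sl (l : seq X) := block_sum (nth 0 l) (ord (size l)) (size l).
(* The premises make [step] solvable for every [l]; [s_ge1] and [goodP] show that they hold along
   the sequence. *)
pose step (l : seq X) (v : X) := (size l = 0%N -> v = x0) /\ ((0 < size l)%N ->
  (forall j, (j < size l)%N -> annihilator G (nth 0 l j)) -> sl l != 0 ->
  [/\ annihilator (G `|` Fl l) v, `|v| = `|sl l| &
      `|sl l + v| <= `|sl l| + 2^-1 ^+ size l]).
have [l|w wP] := @strong_recursion X step.
  have [l0|l0] := posnP (size l); first by exists x0; split=> //; rewrite l0.
  suff [v hv] : exists v, (forall j, (j < size l)%N -> annihilator G (nth 0 l j)) ->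
      sl l != 0 -> [/\ annihilator (G `|` Fl l) v, `|v| = `|sl l| &
      `|sl l + v| <= `|sl l| + 2^-1 ^+ size l].
    by exists v; split=> // sl0; rewrite sl0 in l0.
  have [s0|s0] := eqVneq (sl l) 0; first by exists 0.
  have [Gl|nGl] := pselect (forall j, (j < size l)%N -> annihilator G (nth 0 l j)); last first.
    by exists x0.
  have ns0 : 0 < `|sl l| by rewrite normr_gt0.
  (* Multiplied by the norm of [sl l], this gap becomes a power of 1/2, a summable increment. *)
  have [||||z [z1 Fz xz]] := bad (`|sl l|^-1 *: sl l) (Fl l) (2^-1 ^+ size l / `|sl l|).
  - by rewrite normrZ normfV normr_id mulVf// gt_eqF.
  - by apply: annihilatorZ; apply: annihilator_sum => j _; exact: Gl.
  - exact: sub_countable (card_image_le _ _) (countableP _).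
  - by rewrite divr_gt0// exprn_gt0// invr_gt0.
  exists (- `|sl l| *: z) => _ _.
  split; first exact: annihilatorZ.
    by rewrite normrZ normrN normr_id z1 mulr1.
  have -> : sl l + - `|sl l| *: z = `|sl l| *: (`|sl l|^-1 *: sl l - z).
    by rewrite scalerBr scalerA divff ?gt_eqF// scale1r scaleNr.
  rewrite normrZ normr_id; apply: le_trans (ler_wpM2l _ (ltW xz)) _ => //.
  by rewrite mulrDr mulr1 mulrCA divff ?gt_eqF// mulr1.
have w0 : w 0%N = x0 by exact: (wP 0%N).1.
have nthw k j : (j < k)%N -> nth 0 (mkseq w k) j = w j by exact: nth_mkseq.
pose s (i : 'I_n.+1) := block_sum w i.
have slE k : sl (mkseq w k) = s (ord k) k.
  by rewrite /sl size_mkseq; apply: eq_block_sum => j; exact: nthw.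
have FlE k q : {in q, forall p, (p.2 < k)%N} ->
    Fl (mkseq w k) (J (ratcomb w q)).
  move=> qk; exists q => //; congr J; apply: eq_big_seq => p /qk pk.
  by rewrite nthw.
have x0E : x0 = ratcomb w [:: (1, 0%N)].
  by rewrite /ratcomb big_seq1/= w0 rmorph1 scale1r.
pose good j := annihilator G (w j) /\
  ((0 < j)%N -> annihilator (Fl (mkseq w j)) (w j)).
(* The norming functional of [x0] is 1 at [x0] and kills all later terms; this is why the blocks
   share [w 0]. *)
have s_ge1 k i : (forall j, (j < k)%N -> good j) -> (0 < k)%N -> 1 <= `|s i k|.
  case: k => // k gk _; have [J1 Jx0] := JP x0.
  apply: le_trans (dual_unit_le (s i k.+1) J1).
  rewrite (_ : J x0 _ = 1)//.
  rewrite /s /block_sum big_mkcond big_ord_recl/= w0 linearD/= Jx0 x01.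
  rewrite linear_sum big1 ?addr0// => j _; case: ifP => _; last exact: linear0.
  have [_ /(_ isT)] := gk (bump 0 j) (ltn_ord (lift ord0 j)); apply.
  by rewrite [in J _]x0E; apply: FlE => p /[!inE] /eqP->.
have goodP k : good k.
  elim/ltn_ind: k => -[_|k IH]; first by split=> //; rewrite w0.
  have [_] := wP k.+1; rewrite size_mkseq slE => /(_ isT)[j jk||].
  - by rewrite nthw//; have [] := IH j jk.
  - by rewrite -normr_gt0 (lt_le_trans _ (s_ge1 _ _ IH _)).
  - by move=> /annihilatorU[Gw Fw] _ _.
have stepP k : (0 < k)%N -> `|w k| = `|s (ord k) k| /\
    `|s (ord k) k + w k| <= `|s (ord k) k| + 2^-1 ^+ k.
  move=> k0; have [_] := wP k; rewrite size_mkseq slE => /(_ k0)[j jk||//].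
    by rewrite nthw//; have [] := goodP j.
  by rewrite -normr_gt0 (lt_le_trans _ (s_ge1 _ _ (fun j _ => goodP j) _)).
have w_ge1 k : 1 <= `|w k|.
  case: k => [|k]; first by rewrite w0 x01.
  by rewrite (stepP k.+1 isT).1 s_ge1.
have blockE i k : (0 < k)%N -> in_block i k = (i == ord k).
  case: k => // k _; rewrite /in_block/= -val_eqE/= inordK ?ltn_pmod// eq_sym.
(* Step k adds at most 2^-k, which is the growth of the bound from k to k + 1. *)
have s_le3 i k : `|s i k| <= 3 - 2 * 2^-1 ^+ k.
  elim: k => [|k IH]; first by rewrite /s /block_sum big_ord0 normr0 expr0; lra.
  rewrite /s block_sumS -/(s i k).
  have e0 : 0 < 2^-1 ^+ k :> R by rewrite exprn_gt0// invr_gt0.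
  have [->|k0] := posnP k.
    by rewrite /s /block_sum big_ord0 add0r /in_block/= w0 x01 expr1; lra.
  rewrite blockE//; have [iE|_] := eqVneq i (ord k).
    rewrite iE in IH *; apply: le_trans (stepP k k0).2 _; rewrite exprS.
    by lra.
  by rewrite addr0; apply: le_trans IH _; rewrite exprS; lra.
have s_bnd i k : `|bidual_embed (s i k)| <= 3.
  apply: le_trans (bidual_norm _) _; apply: le_trans (s_le3 i k) _.
  by have : 0 < 2^-1 ^+ k :> R; [rewrite exprn_gt0// invr_gt0|lra].
have [U [UU ooU]] := ultraFilterLemma eventually_filter.
have /choice[phi phiP] : forall i, exists phi : dual (dual X),
    forall f : dual X, f (s i k) @[k --> U] --> phi f.
  by move=> i; have [phi _ ?] := dual_ultralimit UU (s_bnd i); exists phi.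
have [c [i0 ci0] [y yE]] := dep phi.
pose t k := \sum_i c i *: s i k.
(* Each [phi i] takes at [f] the eventually constant value of [f] on the block sums. *)
have fy (f : dual X) m : (forall j, (m <= j)%N -> f (w j) = 0) -> f y = f (t m).
  move=> f0; have phis i : phi i f = f (s i m).
    apply: (@cvg_unique _ (@norm_hausdorff _ R^o) (f (s i k) @[k --> U])).
      exact: phiP.
    apply: cvg_near_cst; apply: ooU; exists m => // k /= mk.
    exact: block_sum_stable.
  have -> : f y = (\sum_i c i *: phi i) f by rewrite yE.
  rewrite dual_sum linear_sum; apply: eq_bigr => i _.
  by rewrite dualZ phis linearZ.
(* Two estimates by 3 d each will be compared with a jump of norm at least 7 d. *)
pose d := `|c i0| / 7; have d0 : 0 < d by rewrite divr_gt0 ?normr_gt0.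
have [|q yq] := @ratcomb_approx _ _ _ w y _ d d0.
  move=> f f0; rewrite (fy f 0%N)// /t big1 ?linear0// => i _.
  by rewrite /s /block_sum big_ord0 scaler0.
pose m := (\max_(p <- q) p.2).+1.
have qm p : p \in q -> (p.2 < m)%N.
  by move=> pq; rewrite ltnS; exact: (@leq_bigmax_seq _ q predT snd).
(* [v] is within [d] of the difference; as [J v] takes the same value at [t k] and at [y], the norm
   of [v] is below [2 * d]. *)
have close k : (m <= k)%N -> `|t k - ratcomb w q| <= 3 * d.
  move=> mk; have k0 : (0 < k)%N by exact: leq_trans mk.
  have [|q' qq'] := @ratcomb_approx _ _ _ (fun j : 'I_k => w j) (t k - ratcomb w q) _ d d0.
    move=> f f0; have fw j : (j < k)%N -> f (w j) = 0.
      by move=> jk; exact: (f0 (Ordinal jk)).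
    rewrite linearB/= /t linear_sum big1 ?sub0r => [|i _].
      rewrite /ratcomb linear_sum big_seq big1 ?oppr0// => p pq.
      by rewrite linearZ/= fw ?scaler0//; exact: leq_trans (qm p pq) mk.
    by rewrite linearZ/= linear_sum big1 ?scaler0// => j _; exact: fw.
  pose q2 := [seq (p.1, val p.2) | p <- q'].
  have q2E : ratcomb (fun j : 'I_k => w j) q' = ratcomb w q2.
    by rewrite /ratcomb big_map.
  rewrite q2E in qq'; set v := ratcomb w q2 in qq'.
  have [J1 Jv] := JP v.
  have Jw j : (k <= j)%N -> J v (w j) = 0.
    move=> kj; have [_ /(_ (leq_trans k0 kj))] := goodP j; apply.
    by apply: FlE => p /mapP[p' _ ->] /=; exact: leq_trans (ltn_ord _) kj.
  have Jy := fy _ _ Jw.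
  have v2 : `|v| < 2 * d.
    rewrite -Jv (_ : J v v = J v (v - (t k - ratcomb w q)) + J v (y - ratcomb w q)).
      rewrite mulr_natl mulr2n ltrD//; apply: le_lt_trans (dual_unit_le _ J1) _ => //.
      by rewrite distrC.
    by rewrite !linearB/= Jy; lra.
  rewrite -(subrK v (t k - _)); apply: le_trans (ler_normD _ _) _.
  by lra.
(* This index lies beyond [m] and in block [i0] only, so that [t] jumps there by [c i0 *: w k]. *)
pose k := (m * n.+1 + n.+1 + i0)%N.
have mk : (m <= k)%N by rewrite /k -addnA (leq_trans _ (leq_addr _ _))// leq_pmulr.
have k0 : (0 < k)%N by exact: leq_trans mk.
have ki : ord k = i0.
  by apply: val_inj; rewrite /ord /k -mulSnr modnMDl modn_small// inord_val.
have tS : t k.+1 - t k = c i0 *: w k.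
  rewrite /t -sumrB (bigD1 i0)//= big1 ?addr0 => [|i ii0].
    by rewrite -scalerBr /s block_sumS blockE// ki eqxx addrAC subrr add0r.
  by rewrite -scalerBr /s block_sumS blockE// ki (negbTE ii0) addr0 subrr scaler0.
have := ler_normB (t k.+1 - ratcomb w q) (t k - ratcomb w q).
rewrite opprB addrA subrK tS normrZ.
have := close _ mk; have := close _ (leqW mk).
have := ler_wpM2l (normr_ge0 (c i0)) (w_ge1 k).
have : 0 < `|c i0| by rewrite normr_gt0.
rewrite /d mulr1; lra.
Qed.

End SeparatedPoint.

(** * Cardinals and constrained systems *)

Lemma countable_setU (T : Type) (A B : set T) :
  countable A -> countable B -> countable (A `|` B).
Proof.
move=> cA cB; suff -> : A `|` B = \bigcup_b (if b then A else B).
  by apply: bigcup_countable => // -[].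
by apply/seteqP; split=> [x [Ax|Bx]|x [[] _ ?]];
  [exists true|exists false|left|right].
Qed.

Section Embeddings.

Lemma card_leT_inj (K U : Type) (B : set U) :
  [set: K] #<= B <-> exists2 f : K -> U, injective f & forall x, B (f x).
Proof.
split=> [/card_leP/unsquash f|[f finj fB]].
  pose k x : [set: K] := exist _ x (mem_set I : x \in [set: K]).
  exists (fun x => val (f (k x))) => [x y /val_inj|x]; last exact: set_valP.
  by move=> /(inj (mem_set I) (mem_set I))[].
have fE : range f #= [set: K] by apply: inj_card_eq => x y _ _; exact: finj.
by rewrite -(card_le_eql fE); apply: subset_card_le => _ [x _ <-].
Qed.

Definition embeds (K J : Type) : Prop := exists f : K -> J, injective f.

Lemma card_leT_embeds (K U : Type) (B : set U) :
  [set: K] #<= B -> embeds K U.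
Proof. by move=> /card_leT_inj[f finj _]; exists f. Qed.

Lemma embeds_card_leT (K U : Type) : embeds K U -> [set: K] #<= [set: U].
Proof. by move=> [f finj]; apply/card_leT_inj; exists f. Qed.

Lemma embeds_countable (K : Type) (J : countType) : embeds K J -> countable [set: K].
Proof. by move=> /embeds_card_leT /sub_countable; apply; exact: countableP. Qed.

(* A fiber which is not cofinal has a strict upper bound, and choosing one for
   each value of [p] yields a cofinal family indexed by [I]. *)
Lemma regular_pigeonhole (K I : Type) (p : K -> I) : regular_cardinal K ->
  embeds K I \/ exists i, exists2 f : K -> K, injective f & forall k, p (f k) = i.
Proof.
move=> [r [wo _] Kcof]; have rtot x y : r x y || r y x.
  have [|z [[/asboolP zxy lbz] _]] := wo [pred z | `[< z = x \/ z = y >]].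
    by exists x; apply/asboolP; left.
  have zx : r z x by apply: lbz; apply/asboolP; left.
  have zy : r z y by apply: lbz; apply/asboolP; right.
  by case: zxy zx zy => -> zx zy; rewrite ?zx ?zy ?orbT.
have cofK A : cofinal r A -> [set: K] #<= A.
  move=> cA; rewrite (card_le_eql Kcof).
  have [_] := @min_cardP _ (cofinal r) (ex_intro _ A cA); exact.
have [[i /cofK/card_leT_inj[f finj fi]]|ncof] :=
    pselect (exists i, cofinal r [set k | p k = i]).
  by right; exists i, f.
left; have /choice[b bP] : forall i, exists b, forall k, p k = i -> r k b.
  move=> i; apply: contrapT => nb; apply: ncof; exists i => x.
  apply: contrapT => nx; apply: nb; exists x => k pk.
  by have /orP[//|rxk] := rtot k x; case: nx; exists k.
have brange : cofinal r (range b).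
  by move=> x; exists (b (p x)); [exists (p x)|exact: bP].
exact: card_leT_embeds (card_le_trans (cofK _ brange) (card_image_le b setT)).
Qed.

Section RegularUncountable.
Variables (K : Type) (regK : regular_cardinal K) (uncK : ~ countable [set: K]).

Let fiberK (J : Type) (I : countType) (g : K -> J) (p : J -> I) : injective g ->
  exists2 i, True & exists2 f : K -> J, injective f & forall k, p (f k) = i.
Proof.
move=> ginj; have [/embeds_countable//|[i [f finj fi]]] := regular_pigeonhole (p \o g) regK.
by exists i => //; exists (g \o f) => //; exact: inj_comp.
Qed.

Lemma regular_fiber (I : countType) (p : K -> I) :
  exists i, exists2 f : K -> K, injective f & forall k, p (f k) = i.
Proof. by have [i _ h] := @fiberK K I id p (fun _ _ => id); exists i. Qed.

(** If the first coordinate is constant on a copy of [K], the second is injective there. *)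
Lemma embeds_prod (A B : Type) : embeds K (A * B) -> embeds K A \/ embeds K B.
Proof.
move=> [g ginj]; have [|[i [f finj fi]]] := regular_pigeonhole (fst \o g) regK.
  by left.
right; exists (snd \o g \o f) => x y /= e; apply/finj/ginj.
by move: e (fi x) (fi y) => /=; case: (g (f x)) (g (f y)) => [? ?] [? ?] /= -> -> ->.
Qed.

Lemma embeds_sum (A B : Type) : embeds K (A + B) -> embeds K A \/ embeds K B.
Proof.
move=> [g ginj]; pose p (x : A + B) := if x is inl _ then true else false.
have [[] _ [f finj fP]] := @fiberK _ _ g p ginj; [left|right].
  have /choice[h hP] : forall k, exists a, f k = inl a.
    by move=> k; move: (fP k); rewrite /p; case: (f k) => // a _; exists a.
  by exists h => x y hxy; apply: finj; rewrite !hP hxy.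
have /choice[h hP] : forall k, exists a, f k = inr a.
  by move=> k; move: (fP k); rewrite /p; case: (f k) => // a _; exists a.
by exists h => x y hxy; apply: finj; rewrite !hP hxy.
Qed.

(** The length is constant on a copy of [K]. Then either [K] embeds in [A] through the heads, or the
    head is constant on a further copy and the tails are shorter. *)
Lemma embeds_seq (A : Type) : embeds K (seq A) -> embeds K A.
Proof.
move=> [g ginj]; have [n _ [f finj fn]] := @fiberK _ _ g size ginj.
elim: n f finj fn {g ginj} => [|n IH] f finj fn.
  case: uncK; apply: (@embeds_countable _ unit); exists (fun=> tt) => x y _.
  by apply: finj; rewrite (size0nil (fn x)) (size0nil (fn y)).
have /choice[h hP] : forall k, exists a, exists2 l, f k = a :: l & size l = n.
  by move=> k; case: (f k) (fn k) => // a l [sl]; exists a, l.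
have [//|[a [u uinj ua]]] := regular_pigeonhole h regK.
apply: (IH (behead \o f \o u)) => [x y /= e|k /=].
  have [lx fx _] := hP (u x); have [ly fy _] := hP (u y).
  by apply/uinj/finj; move: e; rewrite fx fy !ua /= => ->.
by have [l -> <-] := hP (u k).
Qed.

Lemma embeds_countable_prod (I : countType) (A : Type) :
  embeds K (I * A) -> embeds K A.
Proof. by move=> /embeds_prod[/embeds_countable|]. Qed.

End RegularUncountable.

End Embeddings.

(* [far l x y] reads "x and y are far apart, as witnessed by the label l".
   Enlarging a system only adds constraints, so no well-order is needed to
   build one by transfinite induction: Zorn's lemma applies to inclusion. *)
Section ConstrainedSystems.
Variables (V C L : Type) (P : set V) (kills : C -> V -> Prop).
Variable far : L -> V -> V -> Prop.
Hypothesis far_sym : forall l x y, far l x y -> far l y x.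
Hypothesis far_irr : forall l x, ~ far l x x.
Implicit Types T : set (V * set C * L).

Definition common_zeros (G : set C) : set V :=
  [set x | forall c, G c -> kills c x].

Definition constraints T : set C := \bigcup_(t in T) t.1.2.

Definition isolates (G : set C) (l : L) (x : V) : Prop :=
  forall z, P z -> common_zeros G z -> far l x z.

(** The system is unordered, so either label of a pair may witness that it is far apart. *)
Definition far_system T : Prop :=
  [/\ forall t, T t -> P t.1.1 /\ countable t.1.2,
      forall t, T t -> isolates (constraints T) t.2 t.1.1 &
      forall s t, T s -> T t -> s <> t ->
        far s.2 s.1.1 t.1.1 \/ far t.2 s.1.1 t.1.1].

Lemma isolates_sub G G' l x : G `<=` G' -> isolates G l x -> isolates G' l x.
Proof. by move=> GG' h z Pz G'z; apply: h => // c /GG'; exact: G'z. Qed.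

Lemma constraints_sub T T' : T `<=` T' -> constraints T `<=` constraints T'.
Proof. by move=> TT' c [t /TT' Tt tc]; exists t. Qed.

Lemma far_system_bigcup (S : set (set (V * set C * L))) :
  S `<=` far_system -> total_on S subset -> far_system (\bigcup_(T in S) T).
Proof.
move=> Ssep Stot; split=> [t [T ST Tt]|t [T ST Tt]|s t [A SA As] [B SB Bt] st].
- by have [h _ _] := Ssep _ ST; exact: h.
- have [_ h _] := Ssep _ ST; apply: isolates_sub (h t Tt).
  by apply: constraints_sub => s Ts; exists T.
- by have [/(_ _ As) Bs|/(_ _ Bt) At] := Stot _ _ SA SB;
    [have [_ _] := Ssep _ SB|have [_ _] := Ssep _ SA]; apply.
Qed.

(** [x] satisfies every earlier constraint, so each earlier vector, being isolated by them, is far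
    from it; isolation survives as constraints grow. *)
Lemma far_system_extend T x F l : far_system T ->
    P x -> common_zeros (constraints T) x -> countable F ->
    isolates (constraints T `|` F) l x ->
  far_system ((x, F, l) |` T).
Proof.
move=> [T1 T2 T3] Px Tx cF lx; set t0 := (x, F, l).
have new t : T t -> far t.2 t.1.1 x by move=> Tt; exact: T2.
split=> [t [->|/T1]//|u [->|Tu]|u v [->|Tu] [->|Tv] // uv].
- apply: isolates_sub lx => c [[t Tt ct]|Fc]; first by exists t => //; right.
  by exists t0 => //; left.
- by apply: isolates_sub (T2 u Tu); apply: constraints_sub => v Tv; right.
- by right; apply: far_sym; exact: new.
- by left; exact: new.
- exact: T3.
Qed.

Lemma maximal_far_system : exists2 T, far_system T &
  forall x F l, P x -> common_zeros (constraints T) x -> countable F ->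
    ~ isolates (constraints T `|` F) l x.
Proof.
have [T [sT Tmax]] := Zorn_bigcup far_system_bigcup.
exists T => // x F l Px Tx cF lx.
apply: (Tmax ((x, F, l) |` T)); last exact: far_system_extend.
split=> [t|]; first by right.
(* Were the triple already in [T], its vector would be far from itself. *)
move=> /(_ (x, F, l) (or_introl erefl)) xT; have [_ h _] := sT.
exact: far_irr (h _ xT x Px Tx).
Qed.

Lemma far_system_inj T s t : far_system T -> T s -> T t -> s.1.1 = t.1.1 -> s = t.
Proof.
move=> [_ _ T3] Ts Tt st; apply: contrapT => /(T3 _ _ Ts Tt).
by rewrite st => -[]; exact: far_irr.
Qed.

End ConstrainedSystems.

(** * Separated subsets of quasi-reflexive spaces *)

Section DensityBound.
Variables (R : realType) (X : normedModType R).

(** The norm need not be attained, hence the factor 2. *)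
Lemma half_norming (f : dual X) : exists2 x, `|x| <= 1 & `|f| <= 2 * f x.
Proof.
have [->|f0] := eqVneq f 0.
  by exists 0; rewrite ?normr0// linear0 mulr0.
have fpos : 0 < `|f| by rewrite normr_gt0.
have [_ [x /= x1 <-] fx] : exists2 r, [set `|f x| | x in [set x | `|x| <= 1]] r
    & `|f| / 2 < r.
  apply: sup_gt; first by exists `|f 0|, 0 => //=; rewrite normr0.
  by rewrite -[ltRHS]/(`|f|); lra.
have [fx0|fx0] := leP 0 (f x).
  by exists x => //; rewrite ger0_norm// in fx; lra.
exists (- x); first by rewrite normrN.
by rewrite linearN/=; rewrite ltr0_norm// in fx; lra.
Qed.

(** Totality over the bidual makes the rational span of [e] dense in the dual. The vectors [u]
    half-norm its elements, so that a functional vanishing on [u] is 0. *)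
Lemma dense_of_total_bidual (I : Type) (e : I -> dual X) :
    (forall phi : dual (dual X), (forall i, phi (e i) = 0) -> phi = 0) ->
  exists u : seq (rat * I) -> X, dense (range (ratcomb u)).
Proof.
move=> etot; have /choice[u uP] : forall q : seq (rat * I), exists x,
    `|x| <= 1 /\ `|ratcomb e q| <= 2 * ratcomb e q x.
  by move=> q; have [x] := half_norming (ratcomb e q); exists x.
exists u; apply: ratcomb_dense => f fu.
apply/normr0_eq0/eqP; rewrite -[_ == 0]negbK; apply/negP => f0.
have {}f0 : 0 < `|f| by rewrite normr_gt0 -normr_eq0.
(* With g this combination, |g| <= 2 (g - f)(u q) < |f|/2, whence |f| < 3/4 |f|. *)
have [|q fq] := @ratcomb_approx _ _ _ e f _ (`|f| / 4) (divr_gt0 f0 (ltr0Sn _ 3)).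
  by move=> phi phie; rewrite (etot phi).
have [u1 uq] := uP q.
have : (ratcomb e q - f) (u q) <= `|f - ratcomb e q|.
  apply: le_trans (ler_norm _) _; apply: le_trans (ler_dual _ _) _.
  by rewrite distrC ler_piMr.
rewrite dualB fu subr0 => h.
have := ler_normD (f - ratcomb e q) (ratcomb e q); rewrite subrK.
by lra.
Qed.

(* The annihilator of [e] in the bidual meets X trivially, so it is finite
   dimensional and is killed by finitely many further functionals. *)
Lemma total_bidual_extension (I : Type) (e : I -> dual X) : quasi_reflexive X ->
    (forall x, (forall i, e i x = 0) -> x = 0) ->
  exists g : nat -> dual X, forall phi : dual (dual X),
    (forall i, phi (e i) = 0) -> (forall k, phi (g k) = 0) -> phi = 0.
Proof.
move=> /quasi_reflexive_dependence[n dep] etot; apply: contrapT => nex.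
have {}nex (l : seq (dual X)) : exists phi : dual (dual X),
    [/\ forall i, phi (e i) = 0, forall k, phi (nth 0 l k) = 0 & phi != 0].
  apply: contrapT => nphi; apply: nex; exists (nth 0 l) => phi phie phil.
  by apply/eqP; rewrite -[_ == 0]negbK; apply/negP => phi0; apply: nphi; exists phi.
(* The recursion builds a triangular system: [v.1] kills the earlier functionals but not its own
   [v.2]. *)
pose step (l : seq (dual (dual X) * dual X)) (v : dual (dual X) * dual X) :=
  [/\ forall i, v.1 (e i) = 0, forall k, v.1 (nth 0 (map snd l) k) = 0 & v.1 v.2 != 0].
have [l|w wP] := @strong_recursion _ step.
  have [phi [phie phil phi0]] := nex (map snd l).
  suff [f phif] : exists f, phi f != 0 by exists (phi, f).
  apply: contrapT => nf; case/eqP: phi0; apply: dual_ext => f.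
  by apply/eqP; rewrite -[_ == _]negbK; apply/negP => phif; apply: nf; exists f.
have wlt j k : (j < k)%N -> (w k).1 (w j).2 = 0.
  move=> jk; have [_ /(_ j) + _] := wP k.
  by rewrite (nth_map 0) ?size_mkseq// nth_mkseq.
(* The combination lies in X and is killed by [e], so it is 0; its value at the functional of least
   index with nonzero coefficient contradicts triangularity. *)
have [c [i0 ci0] [y yE]] := dep (fun i => (w i).1).
have y0 : y = 0.
  apply: etot => i; rewrite -[LHS]/(bidual_embed y (e i)) -yE dual_sum big1// => j _.
  by have [we _ _] := wP j; rewrite dualZ we mulr0.
have [i ci imin] := arg_minnP (P := fun i => c i != 0) (fun i : 'I_n.+1 => val i) ci0.
have : (\sum_j c j *: (w j).1) (w i).2 = 0 by rewrite yE y0; exact: linear0.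
rewrite dual_sum (bigD1 i)//= big1 ?addr0 => [|j ji].
  rewrite -[LHS]/(c i * (w i).1 (w i).2) => /eqP.
  by rewrite mulf_eq0 (negbTE ci)/=; apply/negP; have [] := wP i.
rewrite -[LHS]/(c j * (w j).1 (w i).2).
have [ij|ji'] := ltnP i j; first by rewrite wlt// mulr0.
have [/imin ij|/negbNE/eqP->] := boolP (c j != 0); last by rewrite mul0r.
by case/eqP: ji; apply/val_inj/eqP; rewrite eqn_leq ij ji'.
Qed.

Lemma quasi_reflexive_dense (I : Type) (e : I -> dual X) : quasi_reflexive X ->
    (forall x, (forall i, e i x = 0) -> x = 0) ->
  exists u : seq (rat * (I + nat)) -> X, dense (range (ratcomb u)).
Proof.
move=> qX /(total_bidual_extension qX)[g gP].
apply: (@dense_of_total_bidual _ (fun i => match i with inl i => e i | inr k => g k end)).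
by move=> phi phi0; apply: gP => [i|k]; [exact: (phi0 (inl i))|exact: (phi0 (inr k))].
Qed.

End DensityBound.

(** * Maximal separated systems and their cardinality *)

Section SeparatedSystems.
Variables (R : realType) (X : normedModType R).

(** Gaps range over a countable set so that the pigeonhole principle applies to the labels. *)
Definition far_by (n : nat) (x y : X) : Prop := 1 + n.+1%:R^-1 <= `|x - y|.

Lemma far_by_sym n x y : far_by n x y -> far_by n y x.
Proof. by rewrite /far_by distrC. Qed.

Lemma far_by_irr n x : ~ far_by n x x.
Proof.
rewrite /far_by subrr normr0 leNgt => /negP; apply.
by rewrite addr_gt0 ?invr_gt0.
Qed.

Definition separated_system : set (set (X * set (dual X) * nat)) :=
  far_system (unit_sphere X) (fun (f : dual X) x => f x = 0) far_by.

Lemma invS_le (e : R) : 0 < e -> exists n, n.+1%:R^-1 <= e.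
Proof.
move=> e0; exists (Num.truncn e^-1).
rewrite -[leRHS]invrK lef_pV2 ?posrE ?invr_gt0 ?ltr0n//.
by rewrite ltW// truncnS_gt.
Qed.

(** By maximality no isolated vector can be added, so the largeness hypothesis of
    [exists_locally_separated] fails for some countable [F]. *)
Lemma maximal_separated_system : quasi_reflexive X ->
  exists2 T, separated_system T & exists2 F, countable F &
    forall x, annihilator (constraints T `|` F) x -> x = 0.
Proof.
move=> qX; have [T sT Tmax] := @maximal_far_system _ _ _ (unit_sphere X)
  (fun (f : dual X) x => f x = 0) far_by far_by_sym far_by_irr.
exists T => //; apply: contrapT => nF.
have [|x [F [eps [x1 Tx cF eps0 lx]]]] := exists_locally_separated (G := constraints T) qX.
  move=> F cF; apply: contrapT => nz; apply: nF; exists F => // x Fx.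
  apply/eqP; rewrite -[_ == 0]negbK; apply/negP => x0; apply: nz.
  exists (`|x|^-1 *: x); last exact: annihilatorZ.
  by rewrite normrZ normfV normr_id mulVf ?normr_eq0.
have [n neps] := invS_le eps0.
apply: (Tmax x F n) => // z z1 Fz; apply: le_trans (lx z z1 Fz).
by rewrite lerD2l.
Qed.

(** Values outside [A] are allowed, which covers the empty set; the applications only need every
    member to be listed. *)
Lemma countable_enum (T : pointedType) (A : set T) : countable A ->
  exists e : nat -> T, forall a, A a -> exists n, e n = a.
Proof.
move=> /countable_injP[f finj].
exists (fun n => xget point [set a | A a /\ f a = n]) => a Aa.
exists (f a); case: xgetP => [b _ [Ab fab]|/(_ a)[]//].
by apply: finj => //; exact/mem_set.
Qed.

(** Each constraint set is enumerated by [nat]; the two further copies of [nat] list [F] and the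
    functionals from [total_bidual_extension]. *)
Lemma quasi_reflexive_system : quasi_reflexive X ->
  exists2 T, separated_system T &
    exists u : seq (rat * ({t | T t} * nat + nat + nat)) -> X,
      dense (range (ratcomb u)).
Proof.
move=> qX; have [T sT [F cF TF]] := maximal_separated_system qX.
exists T => //.
have /choice[e eP] : forall t : {t | T t}, exists e : nat -> dual X,
    forall f, (sval t).1.2 f -> exists n, e n = f.
  by move=> [t Tt] /=; apply: countable_enum; have [/(_ t Tt)[]] := sT.
have [e' e'P] := countable_enum cF.
apply: (@quasi_reflexive_dense _ _ _
  (fun i => match i with inl (t, n) => e t n | inr n => e' n end)) => // x x0.
apply: TF => f [[t Tt ft]|/e'P[n <-]]; last exact: (x0 (inr n)).
have [n <-] := eP (exist _ t Tt) f ft.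
exact: (x0 (inl (_, n))).
Qed.

Lemma separated_system_inj T s t : separated_system T ->
  T s -> T t -> s.1.1 = t.1.1 -> s = t.
Proof. exact: (far_system_inj far_by_irr). Qed.

Lemma separated_system_delta T n : separated_system T ->
  delta_separated (1 + n.+1%:R^-1) [set t.1.1 | t in [set t | T t /\ t.2 = n]].
Proof.
move=> [_ _ T3] _ _ [s [Ts sn] <-] [t [Tt tn] <-] st.
have [||] := T3 s t Ts Tt; first by move=> e; apply: st; rewrite e.
  by rewrite /far_by sn.
by rewrite /far_by tn.
Qed.

Lemma countable_combinations (J : Type) : countable [set: J] ->
  countable [set: seq (rat * seq (rat * (J * nat + nat + nat)))].
Proof. by move=> /Pcountable[J' JE]; subst J; exact: countableP. Qed.

(** A countable [T] would make X separable; as labels are natural numbers, one of them occurs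
    uncountably often. *)
Lemma quasi_reflexive_uncountable : ~ separable_space X -> quasi_reflexive X ->
  exists (eps : R) (A : set X), [/\ 0 < eps, A `<=` unit_sphere X, ~ countable A &
    delta_separated (1 + eps) A].
Proof.
move=> nsep qX; have [T sT [u ud]] := quasi_reflexive_system qX.
have ncT : ~ countable T.
  move=> cT; apply: nsep; exists (range (ratcomb u)) => //.
  apply: sub_countable (card_image_le _ _) (countable_combinations _).
  apply: sub_countable cT; apply/card_leT_inj; exists sval => [[s Ss] [t Tt] /= st|[]//].
  exact: eq_exist.
apply: contrapT => nA; apply: ncT.
suff -> : T = \bigcup_n [set t | T t /\ t.2 = n].
  apply: bigcup_countable => // n _; set Tn := (X in countable X).
  have eTn : [set t.1.1 | t in Tn] #= Tn.
    apply: inj_card_eq => s t /set_mem[Ts _] /set_mem[Tt _].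
    exact: (separated_system_inj sT).
  rewrite -(eq_countable eTn); apply: contrapT => nc; apply: nA.
  exists n.+1%:R^-1, [set t.1.1 | t in Tn]; split=> //.
  - by move=> _ [t [Tt _] <-]; have [/(_ t Tt)[]] := sT.
  - exact: separated_system_delta.
by apply/seteqP; split=> [t Tt|t [n _ []]//]; exists t.2.
Qed.

(** [K] embeds in the index set of a dense family. Stripping lists, rationals and countable summands
    leaves an embedding into [T], on a copy of [K] in which the label is constant. *)
Lemma quasi_reflexive_regular (K : Type) : quasi_reflexive X ->
    ~ countable [set: K] -> regular_cardinal K -> [set: K] #<= density X ->
  exists (eps : R) (A : set X), [/\ 0 < eps, A `<=` unit_sphere X, A #= [set: K] &
    delta_separated (1 + eps) A].
Proof.
move=> qX ncK regK Kdens; have [T sT [u ud]] := quasi_reflexive_system qX.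
have : embeds K {t | T t}.
  have [_ /(_ _ ud) dle] := @min_cardP _ (@dense X) (ex_intro _ _ ud).
  have := card_leT_embeds (card_le_trans Kdens (card_le_trans dle (card_image_le _ _))).
  have c := @embeds_countable K nat.
  move=> /(embeds_seq regK ncK)/(embeds_countable_prod regK ncK).
  move=> /(embeds_seq regK ncK)/(embeds_countable_prod regK ncK).
  move=> /(embeds_sum regK ncK)[/(embeds_sum regK ncK)[|/c//]|/c//].
  by move=> /(embeds_prod regK)[//|/c].
move=> [f finj]; have [n [g ginj gn]] := regular_fiber regK ncK (fun k => (sval (f k)).2).
have fgT k : T (sval (f (g k))) by case: (f _).
have hinj : injective (fun k => (sval (f (g k))).1.1).
  move=> k l /(separated_system_inj sT (fgT k) (fgT l)) e.
  apply/ginj/finj; case: (f (g k)) (f (g l)) e => [s Ts] [t Tt] /= st.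
  exact: eq_exist.
exists n.+1%:R^-1, (range (fun k => (sval (f (g k))).1.1)); split.
- by rewrite invr_gt0.
- by move=> _ [k _ <-]; have [/(_ _ (fgT k))[]] := sT.
- by apply: inj_card_eq => k l _ _; exact: hinj.
- have sepn := separated_system_delta (n := n) sT.
  have hn k : [set t.1.1 | t in [set t | T t /\ t.2 = n]] (sval (f (g k))).1.1.
    by exists (sval (f (g k))) => //; split=> //; exact: gn.
  by move=> _ _ [k _ <-] [l _ <-]; apply: sepn.
Qed.

End SeparatedSystems.

(** * Super-reflexive spaces are reflexive *)

Section SuperReflexive.
Variable R : realType.

(** A bidual element is moved to Y by pulling functionals back along [h], represented there by a
    vector, and returned by [k]. *)
Lemma reflexive_isometry (X Y : normedModType R) (h : X -> Y) (k : Y -> X) :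
    linear h -> linear k -> cancel h k -> cancel k h ->
    (forall x, `|h x| = `|x|) -> reflexive_space Y -> reflexive_space X.
Proof.
move=> lh lk hK kH nh rY phi.
have nk y : `|k y| = `|y| by rewrite -nh kH.
have /choice[pull pullP] : forall g : dual Y, exists f : dual X,
    (forall x, f x = g (h x)) /\ `|f| <= `|g|.
  move=> g; have [||x|f fE fg] := @dual_of_bounded R X (g \o h) `|g|.
  - by move=> a x y /=; rewrite lh linearP.
  - exact: normr_ge0.
  - by rewrite -[`|x|]nh; exact: ler_dual.
  - by exists f.
have [||g|Phi PhiE _] := @dual_of_bounded R (dual Y) (phi \o pull) `|phi|.
- move=> a f g /=; rewrite -linearP; congr (phi _).
  by apply: dual_ext => x; rewrite dualD dualZ !(pullP _).1.
- exact: normr_ge0.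
- apply: le_trans (ler_dual _ _) _; rewrite ler_wpM2l//.
  exact: (pullP g).2.
have [y yE] := rY Phi; exists (k y); apply: dual_ext => f.
have [||y'|g gE _] := @dual_of_bounded R Y (f \o k) `|f|.
- by move=> a x x' /=; rewrite lk linearP.
- exact: normr_ge0.
- by rewrite -[`|y'|]nk; exact: ler_dual.
have -> : f = pull g by apply: dual_ext => x; rewrite (pullP g).1 gE/= hK.
rewrite -[LHS]/((phi \o pull) g) -PhiE yE.
by rewrite -[LHS]/(g y) -[RHS]/(pull g (k y)) (pullP g).1 kH.
Qed.

(* The ultrapower along the unique ultrafilter on a point is X itself. *)
Lemma super_reflexive_reflexive (X : normedModType R) :
  super_reflexive X -> reflexive_space X.
Proof.
pose ultra1 : UltraFilter (principal_filter tt) := principal_filter_ultra tt.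
move=> /(_ unit _ ultra1).
have bP (x : X) : (fun=> x) \in @bounded_family_pred R X unit.
  by apply/asboolP; exists `|x|.
pose Y := ultrapower X ultra1.
pose pr : bounded_family X unit -> Y := quot_proj (null_family_submod_closed X ultra1).
pose h (x : X) : Y := pr (BoundedFamily (bP x)).
pose k (y : Y) : X := (quot_repr y : bounded_family X unit) tt.
have bE (b : bounded_family X unit) : b = BoundedFamily (bP (b tt)).
  by apply/val_inj/funext => -[].
have prK b : k (pr b) = b tt.
  have /quot_projE/asboolP : pr (quot_repr (pr b)) = pr b by exact: quot_reprK.
  set z := quot_repr (pr b) - b => z0.
  have zE : z i @[i --> principal_filter tt] --> k (pr b) - b tt.
    rewrite (_ : (fun i => _) = (fun=> k (pr b) - b tt)); first exact: cvg_cst.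
    by apply/funext => -[].
  by apply/subr0_eq/esym; exact: (cvg_unique _ z0 zE).
have hK : cancel h k by move=> x; rewrite /h prK.
have kH : cancel k h.
  by move=> y; rewrite -[RHS](quot_reprK y) [in RHS](bE (quot_repr y)).
have lh : linear h.
  have prD : {morph pr : b c / b + c} by exact: quot_projD.
  have prZ a b : pr (a *: b) = (a *: pr b : Y) by exact: quot_projZ.
  by move=> a x y; rewrite /h -prZ -prD; congr pr; exact/val_inj.
have lk : linear k by move=> a x y; rewrite -{1}(kH x) -{1}(kH y) -lh hK.
have nh x : `|h x| = `|x|.
  rewrite -[LHS]/(ultrapower_norm (h x)) /h ultrapower_norm_proj.
  apply: cvg_lim; first exact: norm_hausdorff.
  by rewrite (_ : (fun i => _) = (fun=> `|x|)) //; exact: cvg_cst.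
exact: reflexive_isometry lh lk hK kH nh.
Qed.

End SuperReflexive.

(** * Duals of weakly Lindelof determined spaces *)

Section CorsonCoordinates.
Variables (R : realType) (X : normedModType R) (Gamma : Type).

(* Coordinates of the dual ball in a Sigma-product, continuity being expressed
   along ultrafilters. *)
Definition corson_coordinates (h : dual X -> Gamma -> R) : Prop :=
  [/\ forall p, `|p| <= 1 -> countable [set c | h p c != 0],
      forall p q, `|p| <= 1 -> `|q| <= 1 -> h p = h q -> p = q &
      forall (I : Type) (U : set_system I) (F : I -> dual X) (p : dual X),
        UltraFilter U -> (forall i, `|F i| <= 1) -> `|p| <= 1 ->
        (forall x, F i x @[i --> U] --> p x) ->
        forall c, h (F i) c @[i --> U] --> h p c].

End CorsonCoordinates.

Section WLD.
Variables (R : realType) (X : normedModType R).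

Lemma weak_star_cvg (I : Type) (U : set_system I) (F : I -> dual X) (p : dual X) :
  Filter U -> (forall x, F i x @[i --> U] --> p x) ->
  (F i : weak_star X) @[i --> U] --> (p : weak_star X).
Proof.
move=> FU Fp; have Fptws : (F i : {ptws X -> R}) @[i --> U] --> (p : {ptws X -> R}).
  apply/pointwise_cvgP => x; exact: Fp.
move=> A /= [_ [[B oB <-] Bp] BA].
have /Fptws FB : nbhs (p : {ptws X -> R}) B by exact: open_nbhs_nbhs.
by apply: (@filterS _ U FU _ _ _ FB) => i /= Bi; apply: BA.
Qed.

Lemma ptws_eval_continuous (G : Type) (c : G) :
  continuous (fun f : {ptws G -> R} => f c).
Proof. by elim/Peq: G => G in c *; exact: (@proj_continuous G (fun=> R) c). Qed.

Lemma weakly_Lindelof_determined_coordinates : weakly_Lindelof_determined X ->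
  exists (Gamma : Type) (h : dual X -> Gamma -> R), corson_coordinates h.
Proof.
move=> [Gamma [S [Ssigma _ [h [g [hS hK hcont _]]]]]].
exists Gamma, h; split.
- by move=> p p1; apply: Ssigma; rewrite -hS; exists p.
- move=> p q p1 q1 e; rewrite -(hK p) ?inE// -(hK q) ?inE//.
  by congr g.
- move=> I U F p UU F1 p1 Fp c.
  have Fw : F i @[i --> U] --> within (closed_unit_ball (X:=dual X)) (nbhs (p : weak_star X)).
    have FU : Filter U by typeclasses eauto.
    have wF := weak_star_cvg FU Fp.
    move=> A /= /wF FA; apply: (@filterS _ U FU _ _ _ FA) => i /= h1.
    by apply: h1; exact: F1.
  have /subspace_continuousP/(_ p p1) hp := hcont.
  have : (h (F i) : {ptws Gamma -> R}) @[i --> U] --> (h p : {ptws Gamma -> R}).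
    exact: cvg_trans (cvg_app h Fw) hp.
  move=> hF; have := @ptws_eval_continuous Gamma c (h p).
  exact: (cvg_trans (cvg_app _ hF)).
Qed.

End WLD.

Section CorsonDual.
Variables (R : realType) (X : normedModType R) (Gamma : Type).
Variables (h : dual X -> Gamma -> R) (hP : corson_coordinates h).

(** Up to 1/(n + 1), a coordinate depends on finitely many vectors: otherwise pairs agreeing on ever
    larger lists, yet apart at [c], would have a common ultralimit. *)
Lemma coordinate_determined c : exists2 D : set X, countable D &
  forall p q : dual X, `|p| <= 1 -> `|q| <= 1 -> (forall x, D x -> p x = q x) ->
    h p c = h q c.
Proof.
have [_ _ hcvg] := hP.
have /choice[l lP] : forall n, exists l : seq X, forall p q : dual X, `|p| <= 1 -> `|q| <= 1 ->
    (forall x, x \in l -> p x = q x) -> `|h p c - h q c| < n.+1%:R^-1.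
  move=> n; apply: contrapT => nl.
  have /choice[P PP] : forall l : seq X, exists pq : dual X * dual X,
      [/\ `|pq.1| <= 1, `|pq.2| <= 1, forall x, x \in l -> pq.1 x = pq.2 x &
          n.+1%:R^-1 <= `|h pq.1 c - h pq.2 c|].
    move=> l; apply: contrapT => npq; apply: nl; exists l => p q p1 q1 pq.
    by rewrite ltNge; apply/negP => hpq; apply: npq; exists (p, q).
  pose F := filter_from [set: seq X] (fun l => [set l' : seq X | {subset l <= l'}]).
  have FF : ProperFilter F.
    apply: filter_from_proper; last by move=> l _; exists l => x.
    apply: filter_from_filter; first by exists [::].
    move=> l1 l2 _ _; exists (l1 ++ l2) => // l' l'P.
    by split=> x xl; apply: l'P; rewrite mem_cat xl ?orbT.
  have [U [UU FU]] := ultraFilterLemma FF.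
  have P1 l : `|(P l).1| <= 1 by have [] := PP l.
  have P2 l : `|(P l).2| <= 1 by have [] := PP l.
  have [p p1 pP] := dual_ultralimit UU P1.
  have [q q1 qP] := dual_ultralimit UU P2.
  have pq : p = q.
    apply: dual_ext => x; apply: (@cvg_unique _ (@norm_hausdorff _ R^o) _ _ _ _ (pP x)).
    apply: cvg_trans (qP x); apply: near_eq_cvg; apply: FU; exists [:: x] => // l' xl'.
    by have [_ _ ->//] := PP l'; apply: xl'; rewrite inE.
  have hp := hcvg _ _ _ _ UU P1 p1 pP c.
  have := hcvg _ _ _ _ UU P2 q1 qP c; rewrite -pq => hq.
  have hpq : (h (P l).1 c - h (P l).2 c) @[l --> U] --> h p c - h p c by exact: cvgB.
  have hpq0 : `|h (P l).1 c - h (P l).2 c| @[l --> U] --> (0 : R).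
    by rewrite -(@normr0 _ R) -(subrr (h p c)); exact: cvg_norm hpq.
  have : n.+1%:R^-1 <= 0 :> R.
    apply: (cvgr_to_ge hpq0).
    by apply: nearW => l; have [] := PP l.
  by rewrite leNgt invr_gt0 ltr0n.
exists (\bigcup_n [set` l n]).
  by apply: bigcup_countable => // n _; exact: finite_set_countable.
move=> p q p1 q1 pq; apply/eqP; rewrite -subr_eq0 -normr_le0 leNgt; apply/negP.
move=> /invS_le[n]; rewrite leNgt => /negP; apply.
by apply: lP => // x xl; apply: pq; exists n.
Qed.

Lemma coordinates_determined (A : set Gamma) : countable A ->
  exists2 D : set X, countable D &
  forall p q : dual X, `|p| <= 1 -> `|q| <= 1 -> (forall x, D x -> p x = q x) ->
    forall c, A c -> h p c = h q c.
Proof.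
have /choice[D DP] : forall c, exists D : set X, countable D /\
    forall p q : dual X, `|p| <= 1 -> `|q| <= 1 -> (forall x, D x -> p x = q x) -> h p c = h q c.
  by move=> c; have [D] := coordinate_determined c; exists D.
move=> cA; exists (\bigcup_(c in A) D c).
  by apply: bigcup_countable => // c _; exact: (DP c).1.
move=> p q p1 q1 pq c Ac; apply: (DP c).2 => // x Dx.
by apply: pq; exists c.
Qed.

Section Approximations.
Variables (f0 : dual X) (D0 : set X).

(* [A] carries the Corson support of [f], and [D] determines the coordinates
   in [A]. *)
Definition corson_approximation (t : dual X * set X * set Gamma) : Prop :=
  let: (f, D, A) := t in
  [/\ `|f| <= 1, D0 `<=` D, forall x, D0 x -> f x = f0 x &
   [/\ countable D, countable A, forall c, h f c != 0 -> A c &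
       forall p q : dual X, `|p| <= 1 -> `|q| <= 1 -> (forall x, D x -> p x = q x) ->
         forall c, A c -> h p c = h q c]].

Definition strict_extension (t u : dual X * set X * set Gamma) : Prop :=
  [/\ t.1.2 `<=` u.1.2, t.2 `<=` u.2, forall x, t.1.2 x -> u.1.1 x = t.1.1 x &
      exists2 x, u.1.2 x & u.1.1 x <> t.1.1 x].

(** Add the support of [f] to [A], then to [D] countably many vectors determining those
    coordinates. *)
Lemma corson_approximation_exists (f : dual X) (D : set X) (A : set Gamma) : `|f| <= 1 -> D0 `<=` D ->
    (forall x, D0 x -> f x = f0 x) -> countable D -> countable A ->
  exists D' A', [/\ corson_approximation (f, D', A'), D `<=` D' & A `<=` A'].
Proof.
move=> f1 D0D ff0 cD cA; have [hsupp _ _] := hP.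
pose A' := A `|` [set c | h f c != 0].
have cA' : countable A' by apply: countable_setU => //; exact: hsupp.
have [E cE EP] := coordinates_determined cA'.
exists (D `|` E), A'; split=> [|x|c]; [|by left|by left].
split=> //; first by move=> x /D0D; left.
split=> //; [exact: countable_setU|by move=> c; right|].
by move=> p q p1 q1 pq; apply: EP => // x Ex; apply: pq; right.
Qed.

Lemma strict_extension_trans t u v :
  strict_extension t u -> strict_extension u v -> strict_extension t v.
Proof.
move=> [D1 A1 f1 [x ux xne]] [D2 A2 f2 _]; split.
- exact: subset_trans D2.
- exact: subset_trans A2.
- by move=> y ty; rewrite f2 ?f1//; exact: D1.
- by exists x; [exact: D2|rewrite f2].
Qed.

Lemma strict_extension_irr t : ~ strict_extension t t.
Proof. by move=> [_ _ _ [x _]]. Qed.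

(* The limit [f] of the chain has countable Corson support, while every strict
   step of the chain adds a point of that support to [A]; hence the chain has
   countable cofinality. *)
Lemma chain_bound (C : set (dual X * set X * set Gamma)) t0 : C t0 ->
    C `<=` corson_approximation ->
    (forall s t, C s -> C t -> [\/ s = t, strict_extension s t | strict_extension t s]) ->
    (forall t, C t -> exists2 u, C u & strict_extension t u) ->
  exists2 m, corson_approximation m & forall t, C t -> strict_extension t m.
Proof.
move=> Ct0 Capp Ctot Cup; have [hsupp hinj _] := hP.
pose tail t := [set u | C u /\ strict_extension t u].
have FF : ProperFilter (filter_from C tail).
  apply: filter_from_proper; last by move=> t /Cup[u Cu tu]; exists u.
  apply: filter_from_filter; first by exists t0.
  move=> s t Cs Ct; have [<-|st|ts] := Ctot _ _ Cs Ct; first by exists s => // u; split.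
    by exists t => // u [Cu tu]; split; split=> //; exact: strict_extension_trans tu.
  by exists s => // u [Cu su]; split; split=> //; exact: strict_extension_trans su.
have [U [UU FU]] := ultraFilterLemma FF.
have {}FU t : C t -> U (tail t) by move=> Ct; apply: FU; exists t.
have /choice[F FE] : forall t, exists f : dual X, `|f| <= 1 /\ (C t -> f = t.1.1).
  move=> t; have [Ct|nCt] := pselect (C t); last by exists 0; rewrite normr0.
  by exists t.1.1; split=> //; move: (Capp _ Ct); case: t {Ct} => -[f D] A [].
have [f f1 fP] := dual_ultralimit UU (fun t => (FE t).1).
have fE t x : C t -> t.1.2 x -> f x = t.1.1 x.
  move=> Ct tx; apply: (@cvg_unique _ (@norm_hausdorff _ R^o) _ _ _ _ (fP x)).
  apply: cvg_near_cst; apply: filterS (FU t Ct) => u [Cu [_ _ tu _]].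
  by rewrite (FE u).2// tu.
have tf t : C t -> `|t.1.1| <= 1.
  by move=> /Capp; case: t => -[g D] A [].
have hfE t c : C t -> t.2 c -> h f c = h t.1.1 c.
  move=> Ct tc; move: (Capp _ Ct) (fE t) (Ct); case: t tc {Ct} => -[g D] A /= Ac.
  by move=> [g1 _ _ [_ _ _ detA]] fg Ct; apply: detA => // x Dx; exact: fg.
have hsupp_t t c : C t -> h t.1.1 c != 0 -> t.2 c.
  by move=> /Capp; case: t => -[g D] A [_ _ _ [_ _ sA _]]; exact: sA.
(* The two functionals differ at some [c], which is not in [s.2], where both have the coordinates of
   [f]; so the coordinate at [c] is 0 for [s] and nonzero for [t], hence for [f]. *)
have new s t : C s -> C t -> strict_extension s t ->
    exists c, [/\ t.2 c, ~ s.2 c & h f c != 0].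
  move=> Cs Ct [_ sAt _ [x _ tsx]].
  have [c hc] : exists c, h t.1.1 c <> h s.1.1 c.
    apply: contrapT => nc; apply: tsx; congr (dual_fun _ x).
    apply: hinj; [exact: tf|exact: tf|apply/funext => c].
    by apply: contrapT => hc; apply: nc; exists c.
  have nsc : ~ s.2 c by move=> sc; apply: hc; rewrite -(hfE s)// -(hfE t)//; exact: sAt.
  have hs0 : h s.1.1 c = 0.
    by apply/eqP; rewrite -[_ == 0]negbK; apply/negP => /(hsupp_t _ _ Cs).
  have tc : t.2 c by apply: hsupp_t => //; apply/eqP; rewrite -hs0.
  by exists c; split=> //; rewrite (hfE t)//; apply/eqP; rewrite -hs0.
have /choice[sel selP] : forall c, exists t, C t /\
    ((exists2 u, C u & u.2 c) -> t.2 c).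
  move=> c; have [[u Cu uc]|nu] := pselect (exists2 u, C u & u.2 c); first by exists u.
  by exists t0; split=> // /nu.
(* Any step beyond [t] adds a coordinate in the countable support of [f], so countably many [sel c]
   are cofinal. *)
have cofinal_sel t : C t -> exists2 c, h f c != 0 & strict_extension t (sel c).
  move=> Ct; have [u Cu tu] := Cup t Ct.
  have [c [uc ntc hc]] := new _ _ Ct Cu tu.
  exists c => //; have [Csel /(_ (ex_intro2 _ _ u Cu uc)) selc] := selP c.
  have [e|//|[_ sel_t _ _]] := Ctot _ _ Ct Csel; first by rewrite -e in selc.
  by case: ntc; exact: sel_t.
pose B := [set c | h f c != 0].
have cB : countable B by exact: hsupp.
pose D := \bigcup_(c in B) (sel c).1.2; pose A := \bigcup_(c in B) (sel c).2.
have selapp c : corson_approximation (sel c) by exact/Capp/(selP c).1.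
have cD : countable D.
  apply: bigcup_countable => // c _; move: (selapp c).
  by case: (sel c) => -[g E] E' [_ _ _ []].
have cA : countable A.
  apply: bigcup_countable => // c _; move: (selapp c).
  by case: (sel c) => -[g E] E' [_ _ _ []].
have D0t t : C t -> D0 `<=` t.1.2 by move=> /Capp; case: t => -[g E] E' [].
have ft0 t x : C t -> D0 x -> t.1.1 x = f0 x.
  by move=> /Capp; case: t => -[g E] E' [_ _ + _]; apply.
have D0D : D0 `<=` D.
  have [c Bc _] := cofinal_sel _ Ct0; move=> x /(D0t _ (selP c).1) ?.
  by exists c.
have [D' [A' [appm DD' AA']]] : exists D' A', [/\ corson_approximation (f, D', A'), D `<=` D' & A `<=` A'].
  apply: corson_approximation_exists => // x D0x.
  by rewrite (fE t0) ?ft0//; exact: (D0t _ Ct0).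
exists (f, D', A') => // t Ct.
have [c Bc [tD tA tf' [x selx txne]]] := cofinal_sel t Ct.
split=> /=.
- by move=> y /tD ?; apply: DD'; exists c.
- by move=> b /tA ?; apply: AA'; exists c.
- by move=> y ty; exact: fE.
- exists x; first by apply: DD'; exists c.
  by rewrite (fE (sel c))//; exact: (selP c).1.
Qed.

Lemma maximal_corson_approximation : `|f0| <= 1 -> countable D0 ->
  exists2 m, corson_approximation m & forall t, corson_approximation t -> ~ strict_extension m t.
Proof.
move=> f01 cD0.
have [D1 [A1 [app0 _ _]]] : exists D' A',
    [/\ corson_approximation (f0, D', A'), D0 `<=` D' & set0 `<=` A'].
  exact: corson_approximation_exists.
pose W := {t | corson_approximation t}; pose w0 : W := exist _ _ app0.
pose le (s t : W) := `[< s = t \/ strict_extension (sval s) (sval t) >].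
have [t||A Atot|m mmax] := @ZL_preorder W w0 le.
- by apply/asboolP; left.
- move=> s t u /asboolP[->//|st] /asboolP[<-|tu]; apply/asboolP; right => //.
  exact: strict_extension_trans tu.
(* A chain with a largest member is bounded by it; otherwise every member has a strict extension in
   the chain, as [chain_bound] requires. *)
- have [[t At tmax]|nmax] := pselect (exists2 t, A t & forall s, A s -> le s t).
    by exists t.
  have [A0|/set0P[t0 At0]] := eqVneq A set0; first by exists w0 => s; rewrite A0.
  have [||| |mm appm mmP] := @chain_bound [set sval t | t in A] (sval t0).
  + by exists t0.
  + by move=> _ [[t appt] _ <-].
  + move=> _ _ [s As <-] [t At <-].
    have [/asboolP[->|st]|/asboolP[->|ts]] := Atot _ _ As At;
      by [constructor 1|constructor 2|constructor 3].
  + move=> _ [t At <-]; apply: contrapT => nu; apply: nmax; exists t => // s As.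
    have [//|/asboolP[->|ts]] := Atot _ _ As At; first exact/asboolP/or_introl.
    by case: nu; exists (sval s) => //; exists s.
  + by exists (exist _ mm appm) => s As; apply/asboolP; right; apply: mmP; exists s.
exists (sval m); first exact: (proj2_sig m).
move=> t appt mt.
have /asboolP[e|tm] := mmax (exist _ t appt) (introT (asboolP _) (or_intror mt)).
  by rewrite -e in mt; exact: strict_extension_irr mt.
exact: strict_extension_irr (strict_extension_trans mt tm).
Qed.

End Approximations.

End CorsonDual.

(** * Uncountable separated sets of functionals *)

Section SeparatedFunctionals.
Variables (R : realType) (X : normedModType R).
Hypothesis nonsepX : ~ separable_space X.

Lemma unit_functional_vanishing (D : set X) : countable D ->
  exists2 g : dual X, `|g| = 1 & forall x, D x -> g x = 0.
Proof.
move=> /countable_enum[e eP].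
have [g ge g0] : exists2 g : dual X, (forall n, g (e n) = 0) & g != 0.
  apply: contrapT => ng; apply: nonsepX; exists (range (ratcomb e)).
    apply: (sub_countable (card_image_le _ _)). exact: countableP.
  apply: ratcomb_dense => f fe; apply/eqP; rewrite -[_ == 0]negbK; apply/negP => f0.
  by apply: ng; exists f.
exists (`|g|^-1 *: g); first by rewrite normrZ normfV normr_id mulVf ?normr_eq0.
by move=> x /eP[n <-]; rewrite dualZ ge mulr0.
Qed.

Let kills (x : X) (f : dual X) : Prop := f x = 0.

Let far (_ : unit) (f g : dual X) : Prop := 1 < `|f - g|.

(** Otherwise the normalization of a maximal approximation [f] is not isolated: a unit [g] at
    distance at most 1 from it vanishes on [D], and f - |f| g is a strict extension. *)
Lemma exists_isolated_functional (Gamma : Type) (h : dual X -> Gamma -> R) (G : set X) :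
    corson_coordinates h -> countable G ->
  exists f D, [/\ `|f| = 1, common_zeros kills G f, countable D &
    isolates (unit_sphere (dual X)) kills far (G `|` D) tt f].
Proof.
move=> hP cG; apply: contrapT => nex.
have bad (f : dual X) (D : set X) : `|f| = 1 -> common_zeros kills G f -> countable D ->
    exists g, [/\ `|g| = 1, common_zeros kills (G `|` D) g & `|f - g| <= 1].
  move=> f1 Gf cD; apply: contrapT => ng; apply: nex; exists f, D; split=> // g g1 Dg.
  by rewrite /far ltNge; apply/negP => fg; apply: ng; exists g.
have [f0 f01 f0G] := unit_functional_vanishing cG.
have [x0 f0x0] : exists x, f0 x != 0.
  apply: contrapT => nx; have : f0 = 0.
    by apply: dual_ext => x; apply/eqP; rewrite -[_ == _]negbK; apply/negP => ?; apply: nx; exists x.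
  by move=> f00; move: f01; rewrite f00 normr0 => /eqP; rewrite eq_sym oner_eq0.
(* Prescribing the value at [x0] keeps every approximation nonzero. *)
have cD0 : countable (G `|` [set x0]) by apply: countable_setU => //; exact: countable1.
have f0le : `|f0| <= 1 by rewrite f01.
have [[[f D] A] appm mmax] := maximal_corson_approximation hP f0le cD0.
have [f1 D0D ff0 [cD cA _ _]] := appm.
have fn0 : `|f| != 0.
  rewrite normr_eq0; apply: contra_neq f0x0 => f00.
  by rewrite -ff0 ?f00//; right.
have fpos : 0 < `|f| by rewrite lt0r fn0 normr_ge0.
have [||g [g1 gGD fg]] := bad (`|f|^-1 *: f) D _ _ cD.
- by rewrite normrZ normfV normr_id mulVf.
- by move=> x Gx; rewrite /kills dualZ ff0 ?f0G ?mulr0//; left.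
have [x1 gx1] : exists x, g x != 0.
  apply: contrapT => nx; have : g = 0.
    by apply: dual_ext => x; apply/eqP; rewrite -[_ == _]negbK; apply/negP => ?; apply: nx; exists x.
  by move=> g0; move: g1; rewrite g0 normr0 => /eqP; rewrite eq_sym oner_eq0.
(* This keeps the norm at most that of [f] and the values on [D], but changes the value at [x1]. *)
pose f' := f - `|f| *: g.
have f'E x : f' x = f x - `|f| * g x by [].
have f'D x : D x -> f' x = f x.
  by move=> Dx; rewrite f'E (gGD x (or_intror Dx)) mulr0 subr0.
have f'1 : `|f'| <= 1.
  apply: le_trans f1; have -> : f' = `|f| *: (`|f|^-1 *: f - g).
    by rewrite scalerBr scalerA divff// scale1r.
  by rewrite normrZ normr_id ler_piMr.
have [D' [A' [app' DD' AA']]] : exists D' A', [/\ corson_approximation h f0 (G `|` [set x0]) (f', D', A'),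
    D `|` [set x1] `<=` D' & A `<=` A'].
  apply: (corson_approximation_exists hP) => //.
  - by move=> x /D0D; left.
  - by move=> x D0x; rewrite f'D ?ff0//; exact: D0D.
  - by apply: countable_setU => //; exact: countable1.
apply: (mmax _ app'); split=> //=.
- by move=> x Dx; apply: DD'; left.
- exists x1; first by apply: DD'; right.
  move=> e; have /eqP : f' x1 = f x1 by exact: e.
  by rewrite f'E subr_eq addrC -subr_eq subrr eq_sym mulf_eq0 (negbTE fn0) (negbTE gx1).
Qed.

(** If a maximal system were countable, so would be its constraints, and one more functional could
    be added. *)
Lemma uncountable_separated_functionals (Gamma : Type) (h : dual X -> Gamma -> R) :
    corson_coordinates h ->
  exists A : set (dual X), [/\ A `<=` unit_sphere (dual X), ~ countable A &
    one_plus_separated A].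
Proof.
move=> hP; have far_sym l f g : far l f g -> far l g f by rewrite /far distrC.
have far_irr l f : ~ far l f f by rewrite /far subrr normr0 ltNge ler01.
have [T sT Tmax] := maximal_far_system (unit_sphere (dual X)) kills far_sym far_irr.
have [T1 T2 T3] := sT.
exists [set t.1.1 | t in T]; split.
- by move=> _ [t Tt <-]; have [] := T1 t Tt.
- have eT : [set t.1.1 | t in T] #= T.
    by apply: inj_card_eq => s t /set_mem Ts /set_mem Tt; exact: (far_system_inj far_irr sT).
  rewrite (eq_countable eT) => cT.
  have cG : countable (constraints T).
    by apply: bigcup_countable => // t Tt; have [] := T1 t Tt.
  have [f [D [f1 Gf cD fD]]] := exists_isolated_functional hP cG.
  exact: (Tmax f D tt).
- move=> _ _ [s Ts <-] [t Tt <-] st.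
  by have [|//|//] := T3 s t Ts Tt; move=> e; apply: st; rewrite e.
Qed.

End SeparatedFunctionals.

Theorem theoremA (R : realType) (X : completeNormedModType R)
    (nonsepX : ~ separable_space X) :
  [/\ quasi_reflexive X ->
        exists A : set X,
          [/\ A `<=` unit_sphere X, ~ countable A & one_plus_separated A],
      super_reflexive X ->
        (forall K : Type, regular_cardinal K -> [set: K] #<= density X ->
           exists (eps : R) (A : set X),
             [/\ 0 < eps, A `<=` unit_sphere X, A #= [set: K] &
                 delta_separated (1 + eps) A]) /\
        (exists (eps : R) (A : set X),
             [/\ 0 < eps, A `<=` unit_sphere X, ~ countable A &
                 delta_separated (1 + eps) A])
    & weakly_Lindelof_determined X ->
      card_lt [set: R] (density X) ->
        exists A : set (dual X),
          [/\ A `<=` unit_sphere (dual X), ~ countable A &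
              one_plus_separated A]].
Proof.
split.
- move=> /(quasi_reflexive_uncountable nonsepX)[eps [A [eps0 AS ncA Asep]]].
  exists A; split=> // x y Ax Ay xy; apply: lt_le_trans (Asep x y Ax Ay xy).
  by rewrite ltrDl.
- move=> /super_reflexive_reflexive/reflexive_quasi_reflexive qX.
  have unc := quasi_reflexive_uncountable nonsepX qX; split=> // K regK Kdens.
  (* A countable [K] embeds in the uncountable separated set already obtained. *)
  have [cK|ncK] := pselect (countable [set: K]); last exact: quasi_reflexive_regular.
  have [eps [A [eps0 AS ncA Asep]]] := unc.
  have /infiniteP natA : infinite_set A by move=> /finite_set_countable.
  have /card_leT_inj[f finj fA] := card_le_trans cK natA.
  exists eps, (range f); split=> //.
  + by move=> _ [k _ <-]; exact: AS.
  + by apply: inj_card_eq => k l _ _; exact: finj.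
  + by move=> _ _ [k _ <-] [l _ <-]; exact: Asep.
- move=> /weakly_Lindelof_determined_coordinates[Gamma [h hP]] _.
  exact: uncountable_separated_functionals hP.
Qed.
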